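(* Assume $W_c$ satisfies Assumption 1, that $H^{W_s}(M)>0$, $C:=R-H^{W_c}(X|Z)>0$, and $\frac{C}{H^{W_s}(M)}V^{W_s}(M)+V^{W_c}(X|Z)>0$. For $t\in(0,\frac12)$ and $\delta>0$ let $k_n:=\big\lfloor \frac{nC}{H^{W_s}(M)}-\delta n^{1-t}\big\rfloor$. Then \[ \lim_{n\to\infty}-\frac1{n^{1-2t}}\log P_j(k_n,n)=\frac12\cdot\frac{\delta^2}{\frac1{(H^{W_s}(M))^2}\Big[\frac{C}{H^{W_s}(M)}V^{W_s}(M)+V^{W_c}(X|Z)\Big]}. \]
   Context: Setup. $\mathcal M$ finite, $W_s$ an irreducible aperiodic transition matrix on $\mathcal M$; message $M^k$ with law $P_{M_1}(m_1)\prod_{i=2}^kW_s(m_i|m_{i-1})$. $\mathcal X$ a finite abelian group, $\mathcal Z$ finite, $W_c=\{W_c(x,z|x',z')\}$ an irreducible aperiodic transition matrix on $\mathcal X\times\mathcal Z$; noise $(X^n,Z^n)$ with law $P_{X_1Z_1}(x_1,z_1)\prod_{i=2}^nW_c(x_i,z_i|x_{i-1},z_{i-1})$. Channel: input $\tilde x^n$ yields output $(x^n,z^n)$ with probability $P_{X^nZ^n}(x^n-\tilde x^n,z^n)$. $P_j(k,n)$ is the minimum over codes $(\mathsf e:\mathcal M^k\to\mathcal X^n,\ \mathsf d:(\mathcal X\times\mathcal Z)^n\to\mathcal M^k)$ of the average decoding error probability. $R:=\log|\mathcal X|$. Assumption 1: $\sum_xW_c(x,z|x',z')$ does not depend on $x'$;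 call it $W_{c,Z}(z|z')$. Entrywise powers $a^t$ of transition probabilities are $0$ when $a=0$; $\lambda(A)$ denotes the Perron–Frobenius eigenvalue. $\theta H^{W_s}_{1-\theta}(M):=\log\lambda\big(W_s(m|m')^{1-\theta}\big)$, $\theta H^{W_c,\downarrow}_{1-\theta}(X|Z):=\log\lambda\big(W_c(x,z|x',z')^{1-\theta}W_{c,Z}(z|z')^{\theta}\big)$. $H^{W_s}(M):=\lim_{\theta\to0}H^{W_s}_{1-\theta}(M)$, $V^{W_s}(M):=\lim_{\theta\to0}\frac{2[H^{W_s}_{1-\theta}(M)-H^{W_s}(M)]}{\theta}$, $H^{W_c}(X|Z):=\lim_{\theta\to0}H^{W_c,\downarrow}_{1-\theta}(X|Z)$, $V^{W_c}(X|Z):=\lim_{\theta\to0}\frac{2[H^{W_c,\downarrow}_{1-\theta}(X|Z)-H^{W_c}(X|Z)]}{\theta}$. *)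

(* Defs.v *)
From HB Require Import structures.
From mathcomp Require Import all_boot all_algebra.
From Stdlib Require Import Reals ClassicalEpsilon.

Set Implicit Arguments.
Unset Strict Implicit.
Unset Printing Implicit Defensive.

Local Open Scope R_scope.

Definition sumR {T : finType} (f : T -> R) : R :=
  foldr (fun i acc => Rplus (f i) acc) R0 (enum T).

Definition powz (a t : R) : R :=
  if Req_EM_T a 0 then 0 else Rpower a t.

(* Matrices indexed by a finite type: A i j.  For a transition matrix,
   W i j = W(i|j). *)
Fixpoint matpow {T : finType} (A : T -> T -> R) (n : nat) : T -> T -> R :=
  match n with
  | O => fun i j => if i == j then 1 else 0
  | S n' => fun i j => sumR (fun l => A i l * matpow A n' l j)
  end.

Definition stochastic {T : finType} (W : T -> T -> R) : Prop :=
  (forall i j, 0 <= W i j) /\ (forall j, sumR (fun i => W i j) = 1).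

Definition irreducible {T : finType} (W : T -> T -> R) : Prop :=
  forall i j, exists n : nat, (0 < n)%nat /\ 0 < matpow W n i j.

Definition aperiodic {T : finType} (W : T -> T -> R) : Prop :=
  forall (i : T) (d : nat),
    (forall n : nat, (0 < n)%nat -> 0 < matpow W n i i -> Nat.divide d n) ->
    d = 1%nat.

Definition irr_aper_transition {T : finType} (W : T -> T -> R) : Prop :=
  stochastic W /\ irreducible W /\ aperiodic W.

Definition distribution {T : finType} (P : T -> R) : Prop :=
  (forall i, 0 <= P i) /\ sumR P = 1.

Definition is_real_eigenvalue {T : finType} (A : T -> T -> R) (r : R) : Prop :=
  exists v : T -> R, (exists i, v i <> 0) /\
    forall i, sumR (fun j => A i j * v j) = r * v i.

(* Perron--Frobenius eigenvalue of a nonnegative matrix: its largest real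
   eigenvalue (= spectral radius). *)
Definition pf_eig {T : finType} (A : T -> T -> R) : R :=
  epsilon (inhabits R0) (fun r => is_real_eigenvalue A r /\
     forall r', is_real_eigenvalue A r' -> r' <= r).

Fixpoint chain_prob {T : finType} (W : T -> T -> R) (prev : T) (s : seq T) : R :=
  match s with
  | [::] => 1
  | a :: s' => W a prev * chain_prob W a s'
  end.

Definition seq_prob {T : finType} (P1 : T -> R) (W : T -> T -> R) (s : seq T) : R :=
  match s with
  | [::] => 1
  | a :: s' => P1 a * chain_prob W a s'
  end.

(* Output y = (x^n, z^n), input xt: noise (x^n - xt^n, z^n). *)
Definition noise_of {X : finZmodType} {Z : finType}
  (y : seq (X * Z)) (xt : seq X) : seq (X * Z) :=
  [seq (GRing.add p.1.1 (GRing.opp p.2), p.1.2) | p <- zip y xt].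

Definition avg_err {M : finType} {X : finZmodType} {Z : finType}
  (P1 : M -> R) (Ws : M -> M -> R) (PXZ1 : X * Z -> R)
  (Wc : X * Z -> X * Z -> R) (k n : nat)
  (e : k.-tuple M -> n.-tuple X) (d : n.-tuple (X * Z) -> k.-tuple M) : R :=
  sumR (fun m : k.-tuple M =>
    seq_prob P1 Ws m *
    sumR (fun y : n.-tuple (X * Z) =>
      if d y == m then 0 else seq_prob PXZ1 Wc (noise_of y (e m)))).

Definition Pj {M : finType} {X : finZmodType} {Z : finType}
  (P1 : M -> R) (Ws : M -> M -> R) (PXZ1 : X * Z -> R)
  (Wc : X * Z -> X * Z -> R) (k n : nat) : R :=
  epsilon (inhabits R0) (fun r =>
    (exists (e : k.-tuple M -> n.-tuple X) (d : n.-tuple (X * Z) -> k.-tuple M),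
       avg_err P1 Ws PXZ1 Wc e d = r) /\
    forall (e : k.-tuple M -> n.-tuple X) (d : n.-tuple (X * Z) -> k.-tuple M),
       r <= avg_err P1 Ws PXZ1 Wc e d).

Definition assumption1 {X : finZmodType} {Z : finType}
  (Wc : X * Z -> X * Z -> R) : Prop :=
  forall (z z' : Z) (x1 x2 : X),
    sumR (fun x => Wc (x, z) (x1, z')) = sumR (fun x => Wc (x, z) (x2, z')).

Definition WcZ {X : finZmodType} {Z : finType}
  (Wc : X * Z -> X * Z -> R) (z z' : Z) : R :=
  sumR (fun x => Wc (x, z) (GRing.zero, z')).

(* theta * H_{1-theta}^{W_s}(M) = log lambda(W_s^{1-theta}) *)
Definition Hs_renyi {M : finType} (Ws : M -> M -> R) (theta : R) : R :=
  ln (pf_eig (fun m m' => powz (Ws m m') (1 - theta))) / theta.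

Definition Hc_renyi {X : finZmodType} {Z : finType}
  (Wc : X * Z -> X * Z -> R) (theta : R) : R :=
  ln (pf_eig (fun a b => powz (Wc a b) (1 - theta) *
                         powz (WcZ Wc a.2 b.2) theta)) / theta.

(* k_n := floor(n C / H - delta n^{1-t}), truncated at 0 *)
Definition kn (C H delta t : R) (n : nat) : nat :=
  Z.to_nat (Int_part (INR n * C / H - delta * Rpower (INR n) (1 - t))).

(* Main.v *)
Require Import Defs.
From HB Require Import structures.
From mathcomp Require Import all_boot all_algebra.
From Stdlib Require Import Reals ClassicalEpsilon Lra Lia.

(** Let pi(m,x,z) = P_M(m) P_{X|Z}(x|z).  For every code and every threshold,
    P_j is at least P[pi <= e^-a / |X|^n] - e^-a, and averaging over uniformly
    random encoders gives a code with error at most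
    P[pi <= e^a / |X|^n] + e^-a; with a of order n^(1-2t) both estimates have
    the same moderate deviation exponent.  The moment generating function of
    -log pi is the product of the total masses of two tilted chains, and it equals
    exp (k log lambda_s(theta) + n log lambda_c(theta)) up to a factor that is
    uniform in theta, because for 0 < theta < 1 the tilted matrices lie entrywise
    between the transition matrix and 1.  At theta = u n^-t the second order
    expansion of log lambda at 0 turns the exponent into
    n^(1-2t) (- delta H u + V u^2 / 2), where H = H^{W_s}(M) and
    V = (C / H) V^{W_s}(M) + V^{W_c}(X|Z).  Chernoff's bound at the minimiser
    u = delta H / V gives achievability, and an exponential tilting argument,
    which involves positive theta only, gives the converse. *)

Set Implicit Arguments.
Unset Strict Implicit.
Unset Printing Implicit Defensive.

Local Open Scope R_scope.

(** * Finite sums of reals *)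

(** Assumption 1 makes [Z^n] a Markov chain with matrix [WcZ], so [P_{X|Z}] is a ratio of two chain
    probabilities; this is why the moment generating function of [-log pi] is a product of total
    masses of chains. Since theta shrinks with n, asymptotics at each fixed theta would not be
    enough. The choice of [k_n] cancels the leading order: [k_n H + n H^{W_c}(X|Z) - n log |X|] is
    [- delta H n^(1-t)] up to O(1). At [theta = u n^-t] this gives the linear term of the exponent,
    while the second order coefficients, weighted by [k_n ~ n C / H] and n, give the quadratic one.
    The deviations of [-log pi] from [n log |X|] that matter live on the scale n^(1-t), far above
    [a] of order n^(1-2t). Hence the opposite shifts of the threshold in the two bounds do not
    affect the exponent. *)

HB.instance Definition _ := Monoid.isComLaw.Build R 0 Rplus
  (fun x y z => esym (Rplus_assoc x y z)) Rplus_comm Rplus_0_l.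
HB.instance Definition _ := Monoid.isMulLaw.Build R 0 Rmult Rmult_0_l Rmult_0_r.
HB.instance Definition _ := Monoid.isAddLaw.Build R Rmult Rplus
  Rmult_plus_distr_r Rmult_plus_distr_l.

Local Notation "\rsum_ ( i : T ) F" := (\big[Rplus/0]_(i : T) F)
  (at level 41, F at level 41, i, T at level 50).
Section Sums.
Variable T : finType.
Implicit Types f g : T -> R.

Lemma sumRE f : sumR f = \rsum_(i : T) f i.
Proof. by rewrite /sumR [index_enum T]unlock unlock /= -enumT. Qed.

Lemma eq_sumR f g : f =1 g -> sumR f = sumR g.
Proof. by move=> fg; rewrite !sumRE; apply: eq_bigr => i _. Qed.

Lemma rsum_le f g : (forall i, f i <= g i) -> sumR f <= sumR g.
Proof.
move=> fg; rewrite !sumRE.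
apply: (big_ind2 (fun x y => x <= y)) => [|x1 x2 y1 y2 *|i _]; [lra|lra|exact: fg].
Qed.

Lemma rsum_ge0 f : (forall i, 0 <= f i) -> 0 <= sumR f.
Proof.
move=> f0; rewrite sumRE; apply: (big_ind (fun x => 0 <= x)) => [|x y *|i _]; [lra|lra|exact: f0].
Qed.

Lemma rsum_mull c f : c * sumR f = sumR (fun i => c * f i).
Proof. by rewrite !sumRE big_distrr. Qed.
Lemma rsum_add f g : sumR (fun i => f i + g i) = sumR f + sumR g.
Proof. by rewrite !sumRE big_split. Qed.
Lemma rsum_term f i : (forall j, 0 <= f j) -> f i <= sumR f.
Proof.
move=> f0; rewrite sumRE (bigD1 i) //=.
suff: 0 <= \big[Rplus/0]_(j | j != i) f j by lra.
by apply: (big_ind (fun x => 0 <= x)) => [|x y *|j _]; [lra|lra|exact: f0].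
Qed.
Lemma rsum_const c : sumR (fun _ : T => c) = INR #|T| * c.
Proof.
rewrite sumRE big_const; elim: #|T| => [|n IH]; first by rewrite /=; lra.
by rewrite iterS IH S_INR; lra.
Qed.
Lemma rsum_delta f i : sumR (fun j => if j == i then f j else 0) = f i.
Proof. by rewrite sumRE -big_mkcond big_pred1_eq. Qed.
End Sums.

Lemma rsum_exch (S T : finType) (f : S -> T -> R) :
  sumR (fun i => sumR (fun j => f i j)) = sumR (fun j => sumR (fun i => f i j)).
Proof.
rewrite !sumRE; under eq_bigr do rewrite sumRE.
rewrite exchange_big /=; by apply: eq_bigr => j _; rewrite sumRE.
Qed.
Lemma rsum_pair (S T : finType) (f : S * T -> R) :
  sumR f = sumR (fun i => sumR (fun j => f (i, j))).
Proof.
rewrite !sumRE; under [RHS]eq_bigr do rewrite sumRE.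
by rewrite pair_bigA /=; apply: eq_bigr => -[].
Qed.
Lemma rsum_reindex (S T : finType) (h : S -> T) (f : T -> R) :
  bijective h -> sumR f = sumR (fun i => f (h i)).
Proof. by move=> hb; rewrite !sumRE (reindex h) //; apply: onW_bij. Qed.

(** * Perron-Frobenius theory of irreducible matrices *)

Lemma rsum_lt (T : finType) (f g : T -> R) i :
  (forall j, f j <= g j) -> f i < g i -> sumR f < sumR g.
Proof.
move=> fg fgi.
have := @rsum_term T (fun j => g j + - 1 * f j) i (fun j => ltac:(have := fg j; lra)).
rewrite rsum_add -rsum_mull; lra.
Qed.

Lemma rsum_ex_pos (T : finType) (f : T -> R) : 0 < sumR f -> exists i, 0 < f i.
Proof.
move=> f0; apply: NNPP => nf.
have : sumR f <= sumR (fun _ : T => 0).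
  by apply: rsum_le => i; case: (Rle_lt_dec (f i) 0) => // fi; case: nf; exists i.
rewrite rsum_const; lra.
Qed.

Lemma finite_lower_bound (T : finType) (f : T -> R) :
  (forall i, 0 < f i) -> exists2 e, 0 < e & forall i, e <= f i.
Proof.
move=> f0.
suff [e e0 He] : exists2 e, 0 < e & forall i, i \in enum T -> e <= f i.
  by exists e => // i; apply: He; rewrite mem_enum.
elim: (enum T) => [|j s [e e0 He]]; first by exists 1; [lra|].
exists (Rmin e (f j)); first exact: Rmin_glb_lt.
move=> i; rewrite inE => /orP[/eqP->|/He]; first exact: Rmin_r.
by apply: Rle_trans; exact: Rmin_l.
Qed.

(** * Limits and compactness in finite dimension *)

Lemma Un_cv_sumR (T : finType) (f : nat -> T -> R) (l : T -> R) :
  (forall i, Un_cv (fun n => f n i) (l i)) -> Un_cv (fun n => sumR (f n)) (sumR l).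
Proof.
move=> fl; rewrite /sumR; elim: (enum T) => [|i s IH] /=.
  by move=> e e0; exists 0%nat => n _; rewrite /Rdist Rminus_diag Rabs_R0.
by apply: (@CV_plus (fun n => f n i)).
Qed.

Lemma Un_cv_const (c : R) : Un_cv (fun _ => c) c.
Proof. by move=> e e0; exists 0%nat => n _; rewrite /Rdist Rminus_diag Rabs_R0. Qed.

Lemma Un_cv_inv_S : Un_cv (fun n => / (INR n + 1)) 0.
Proof.
move=> e e0; have [N [N0 N1]] := archimed_cor1 e e0.
exists N => n /le_INR nN; rewrite /Rdist Rminus_0_r.
have n0 := pos_INR n.
have : 0 < INR N by apply: lt_0_INR.
move=> N2; rewrite Rabs_right; last by apply/Rle_ge/Rlt_le/Rinv_0_lt_compat; lra.
by apply: Rle_lt_trans N0; apply: Rinv_le_contravar => //; lra.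
Qed.

(** A cluster point from Bolzano-Weierstrass is approached within [/ (n + 1)] at some index beyond
    [n]. The indices need not increase: [n <= phi n] suffices to carry limits over and is stable
    under iterated extraction. *)
Lemma unit_interval_subseq (u : nat -> R) : (forall n, 0 <= u n <= 1) ->
  exists (phi : nat -> nat) l,
    (forall n, Peano.le n (phi n)) /\ Un_cv (fun n => u (phi n)) l.
Proof.
move=> u01.
have [l Hl] := Bolzano_Weierstrass u _ (compact_P3 0 1) u01.
have Hex n : { p | Peano.le n p /\ Rabs (u p - l) < / (INR n + 1) }.
  apply: constructive_indefinite_description.
  have n0 := pos_INR n.
  have p0 : 0 < / (INR n + 1) by apply: Rinv_0_lt_compat; lra.
  have [|p [Hp Hlp]] := Hl (disc l (mkposreal _ p0)) n.
    by exists (mkposreal _ p0) => x.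
  by exists p.
exists (fun n => sval (Hex n)), l; split=> [n|e e0].
  by case: (svalP (Hex n)).
have [N HN] := Un_cv_inv_S e0; exists N => n /HN.
rewrite /Rdist Rminus_0_r => He; have [_ H] := svalP (Hex n).
apply: Rlt_trans H _; apply: Rle_lt_trans He; exact: Rle_abs.
Qed.

Lemma Un_cv_subseq (u : nat -> R) l (phi : nat -> nat) :
  (forall n, Peano.le n (phi n)) -> Un_cv u l -> Un_cv (fun n => u (phi n)) l.
Proof.
move=> Hphi ul e /ul[N HN]; exists N => n nN; apply: HN.
by have := Hphi n; move: nN; rewrite /ge; lia.
Qed.

Lemma unit_cube_subseq (T : finType) (x : nat -> T -> R) :
  (forall n i, 0 <= x n i <= 1) ->
  exists (phi : nat -> nat) (y : T -> R),
    (forall n, Peano.le n (phi n)) /\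
    forall i, Un_cv (fun n => x (phi n) i) (y i).
Proof.
move=> x01.
suff [phi [y [H1 H2]]] : exists (phi : nat -> nat) (y : T -> R),
    (forall n, Peano.le n (phi n)) /\
    forall i, i \in enum T -> Un_cv (fun n => x (phi n) i) (y i).
  by exists phi, y; split=> // i; apply: H2; rewrite mem_enum.
elim: (enum T) => [|j s [phi [y [Hphi Hy]]]].
  by exists (fun n => n), (fun=> 0); split=> // n; exact: Peano.le_n.
have [psi [l [Hpsi Hl]]] := unit_interval_subseq (fun n => x01 (phi n) j).
exists (fun n => phi (psi n)), (fun i => if i == j then l else y i); split.
  by move=> n; have := Hphi (psi n); have := Hpsi n; lia.
move=> i; rewrite inE; case: eqP => [-> _|_ /= /Hy H]; first exact: Hl.
exact: (Un_cv_subseq Hpsi H).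
Qed.

Section MatrixPowers.
Variable T : finType.
Implicit Types (A W : T -> T -> R) (i j : T).

Lemma matpow_ge0 A n i j : (forall i j, 0 <= A i j) -> 0 <= matpow A n i j.
Proof.
move=> A0; elim: n i j => [|n IH] i j /=; first by case: ifP => _; lra.
by apply: rsum_ge0 => l; apply: Rmult_le_pos.
Qed.

Lemma matpow_le W A n i j :
  (forall i j, 0 <= W i j <= A i j) -> matpow W n i j <= matpow A n i j.
Proof.
move=> WA; elim: n i j => [|n IH] i j /=; first lra.
apply: rsum_le => l; case: (WA i l) => ? ?.
by apply: Rmult_le_compat => //; apply: matpow_ge0 => a b; case: (WA a b).
Qed.

Lemma matpowSr A n i j :
  matpow A n.+1 i j = sumR (fun l => matpow A n i l * A l j).
Proof.
elim: n i j => [|n IH] i j.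
  transitivity (sumR (fun l => if l == j then A i l else 0)).
    by apply: eq_sumR => l /=; case: eqP => _; lra.
  rewrite rsum_delta.
  transitivity (sumR (fun l => if l == i then A l j else 0)).
    by rewrite rsum_delta.
  by apply: eq_sumR => l /=; rewrite eq_sym; case: eqP => _; lra.
rewrite -[LHS]/(sumR (fun l => A i l * matpow A n.+1 l j)).
under eq_sumR => l do rewrite IH rsum_mull.
rewrite rsum_exch; apply: eq_sumR => l.
rewrite -[matpow A n.+1 i l]/(sumR (fun k => A i k * matpow A n k l)).
rewrite Rmult_comm rsum_mull; apply: eq_sumR => k; lra.
Qed.

Lemma matpow_tr A n i j : matpow (fun a b => A b a) n i j = matpow A n j i.
Proof.
elim: n i j => [|n IH] i j; first by rewrite /= eq_sym.
rewrite matpowSr /=; apply: eq_sumR => l; rewrite IH; lra.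
Qed.

Lemma irreducible_tr A : irreducible A -> irreducible (fun a b => A b a).
Proof. by move=> irr i j; have [n] := irr j i; exists n; rewrite matpow_tr. Qed.

Lemma irreducible_le W A : (forall i j, 0 <= W i j <= A i j) ->
  irreducible W -> irreducible A.
Proof.
move=> WA irr i j; have [n [n0 Hn]] := irr i j; exists n; split=> //.
exact: Rlt_le_trans Hn (matpow_le _ _ _ WA).
Qed.

(** Makes the sum of the powers of [A] below [m] entrywise positive, with one bound for all pairs of
    states. *)
Lemma irreducible_bounded A : irreducible A ->
  exists m : nat, forall i j, exists2 n : nat, (n < m)%nat & 0 < matpow A n i j.
Proof.
move=> irr.
have H (p : T * T) : { n : nat | 0 < matpow A n p.1 p.2 }.
  apply: constructive_indefinite_description.
  by have [n [_ ?]] := irr p.1 p.2; exists n.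
exists (\max_(p : T * T) sval (H p)).+1 => i j.
exists (sval (H (i, j))); last exact: svalP (H (i, j)).
by rewrite ltnS; exact: (@leq_bigmax _ (fun p => sval (H p)) (i, j)).
Qed.

Lemma left_eigen_matpow A u r n j :
  (forall j, sumR (fun i => u i * A i j) = r * u j) ->
  sumR (fun i => u i * matpow A n i j) = r ^ n * u j.
Proof.
move=> Au; elim: n j => [|n IH] j.
  rewrite /= Rmult_1_l -[RHS]rsum_delta.
  by apply: eq_sumR => i; case: eqP => [->|_]; lra.
under eq_sumR => i do rewrite matpowSr rsum_mull.
rewrite rsum_exch /=.
transitivity (sumR (fun l => r ^ n * (u l * A l j))).
  apply: eq_sumR => l; rewrite -Rmult_assoc -IH Rmult_comm rsum_mull.
  by apply: eq_sumR => i; lra.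
by rewrite -rsum_mull Au; lra.
Qed.

End MatrixPowers.

Section Perron.
Variables (T : finType) (A : T -> T -> R) (t0 : T).
Hypothesis A0 : forall i j, 0 <= A i j.
Hypothesis irrA : irreducible A.

Definition collatz_wielandt (r : R) : Prop :=
  exists x : T -> R, [/\ forall i, 0 <= x i, sumR x = 1 &
    forall i, r * x i <= sumR (fun j => A i j * x j)].

Lemma simplex_le1 (x : T -> R) i : (forall i, 0 <= x i) -> sumR x = 1 -> x i <= 1.
Proof. by move=> x0 <-; apply: rsum_term. Qed.

Lemma collatz_wielandt_le r :
  collatz_wielandt r -> r <= sumR (fun i => sumR (fun j => A i j)).
Proof.
case=> x [x0 x1 Hx]; rewrite -[r]Rmult_1_r -x1 rsum_mull.
apply: rsum_le => i; apply: Rle_trans (Hx i) _.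
apply: rsum_le => j; rewrite -{2}[A i j]Rmult_1_r.
by apply: Rmult_le_compat_l => //; apply: simplex_le1.
Qed.

(** Compactness of the simplex: vectors admissible up to [/ (n + 1)] for the supremum [r] have a
    convergent subsequence, and the inequalities pass to the limit. The slack is uniform in [i]
    because coordinates are at most 1. *)
Lemma collatz_wielandt_attained :
  exists2 r, collatz_wielandt r & forall r', collatz_wielandt r' -> r' <= r.
Proof.
have CW0 : collatz_wielandt 0.
  exists (fun i => if i == t0 then 1 else 0); split.
  - by move=> i; case: eqP => _; lra.
  - exact: (rsum_delta (fun _ : T => 1) t0).
  - move=> i; rewrite Rmult_0_l; apply: rsum_ge0 => j.
    by apply: Rmult_le_pos => //; case: eqP => _; lra.
have [||r [ub lub]] := completeness collatz_wielandt.
- by exists (sumR (fun i => sumR (fun j => A i j))) => r /collatz_wielandt_le.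
- by exists 0.
exists r => //.
have Hex (n : nat) : { x : T -> R | [/\ forall i, 0 <= x i, sumR x = 1 &
    forall i, r * x i - / (INR n + 1) <= sumR (fun j => A i j * x j)] }.
  apply: constructive_indefinite_description.
  have n0 := pos_INR n.
  have p0 : 0 < / (INR n + 1) by apply: Rinv_0_lt_compat; lra.
  have [s [Hs rs]] : exists s, collatz_wielandt s /\ r - / (INR n + 1) < s.
    apply: NNPP => nex.
    have : r <= r - / (INR n + 1); last lra.
    apply: lub => s Hs; case: (Rle_lt_dec s (r - / (INR n + 1))) => // ?.
    by case: nex; exists s.
  case: Hs => x [x0 x1 Hx]; exists x; split=> // i.
  have := x0 i; have := simplex_le1 i x0 x1; have := Hx i; nra.
pose x n := sval (Hex n).
have x0 n i : 0 <= x n i by rewrite /x; case: (svalP (Hex n)).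
have xs n : sumR (x n) = 1 by rewrite /x; case: (svalP (Hex n)).
have xA n i : r * x n i - / (INR n + 1) <= sumR (fun j => A i j * x n j).
  by rewrite /x; case: (svalP (Hex n)).
have x01 n i : 0 <= x n i <= 1 by split => //; apply: simplex_le1.
have [phi [y [Hphi Hy]]] := unit_cube_subseq x01.
exists y; split.
- move=> i; apply: (@Rle_cv_lim (fun _ => 0) (fun n => x (phi n) i)) => //.
  exact: Un_cv_const.
- apply: (UL_sequence _ _ _ (Un_cv_sumR Hy)).
  move=> e e0; exists 0%nat => n _; by rewrite xs /Rdist Rminus_diag Rabs_R0.
- move=> i.
  apply: (@Rle_cv_lim (fun n => r * x (phi n) i - / (INR (phi n) + 1))
    (fun n => sumR (fun j => A i j * x (phi n) j))) => //.
    rewrite -[r * y i]Rminus_0_r; apply: (@CV_minus (fun n => r * x (phi n) i) (fun n => / (INR (phi n) + 1))).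
      by apply: (@CV_mult (fun _ => r) (fun n => x (phi n) i)) => //; exact: Un_cv_const.
    by apply: (@Un_cv_subseq (fun n => / (INR n + 1)) 0 phi Hphi); exact: Un_cv_inv_S.
  by apply: (@Un_cv_sumR _ (fun n j => A i j * x (phi n) j)) => j; apply: (@CV_mult (fun _ => A i j) (fun n => x (phi n) j)) => //; exact: Un_cv_const.
Qed.

(** Wielandt's argument. The sum [S] of the powers of [A] below [m] is positive and commutes with
    [A], so [y = S x] is positive and [A y = r y + S d], where [d = A x - r x] is the defect of a
    maximiser. A nonzero [d] would make [S d] positive everywhere and allow a value larger than [r];
    hence [y] is an eigenvector. *)
Lemma perron_right :
  exists r (x : T -> R), [/\ forall i, 0 < x i, sumR x = 1 &
    forall i, sumR (fun j => A i j * x j) = r * x i].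
Proof.
have [r [x [x0 x1 Hx]] rmax] := collatz_wielandt_attained.
have [m Hm] := irreducible_bounded irrA.
pose S i j := sumR (fun n : 'I_m => matpow A n i j).
have S0 i j : 0 < S i j.
  have [n nm Hn] := Hm i j; apply: Rlt_le_trans Hn _.
  by apply: (@rsum_term _ (fun n : 'I_m => matpow A n i j) (Ordinal nm)) => ?; exact: matpow_ge0.
have SA i j : sumR (fun l => A i l * S l j) = sumR (fun l => S i l * A l j).
  under eq_sumR => l do rewrite rsum_mull.
  under [RHS]eq_sumR => l do rewrite Rmult_comm rsum_mull.
  rewrite rsum_exch [RHS]rsum_exch; apply: eq_sumR => n.
  rewrite -[LHS]/(matpow A n.+1 i j) matpowSr.
  by apply: eq_sumR => l; lra.
have Spos (v : T -> R) i : (forall j, 0 <= v j) -> 0 < sumR v -> 0 < sumR (fun j => S i j * v j).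
  move=> v0 /rsum_ex_pos[j vj].
  apply: Rlt_le_trans (Rmult_lt_0_compat _ _ (S0 i j) vj) _.
  by apply: (@rsum_term _ (fun j => S i j * v j)) => k; apply: Rmult_le_pos => //; apply: Rlt_le.
pose d i := sumR (fun j => A i j * x j) - r * x i.
have d0 i : 0 <= d i by have := Hx i; rewrite /d; lra.
pose y i := sumR (fun j => S i j * x j).
have y0 i : 0 < y i by apply: Spos => //; lra.
have Ay i : sumR (fun j => A i j * y j) = r * y i + sumR (fun j => S i j * d j).
  have -> : sumR (fun j => S i j * d j) =
     sumR (fun j => S i j * sumR (fun k => A j k * x k)) - r * y i.
    rewrite /y rsum_mull /Rminus -[- sumR _]Rmult_1_l -Ropp_mult_distr_r Ropp_mult_distr_l.
    rewrite rsum_mull -rsum_add.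
    by apply: eq_sumR => j; rewrite /d; lra.
  transitivity (sumR (fun j => S i j * sumR (fun k => A j k * x k))); last lra.
  rewrite /y; under eq_sumR => j do rewrite rsum_mull.
  under [RHS]eq_sumR => j do rewrite rsum_mull.
  rewrite rsum_exch [RHS]rsum_exch; apply: eq_sumR => k.
  transitivity (x k * sumR (fun l => A i l * S l k)).
    by rewrite rsum_mull; apply: eq_sumR => l; lra.
  by rewrite SA rsum_mull; apply: eq_sumR => l; lra.
have dz i : d i = 0.
  apply: NNPP => di.
  have ds : 0 < sumR d.
    apply: (@Rlt_le_trans _ (d i)); first by have := d0 i; lra.
    exact: rsum_term.
  (* [e] is a lower bound of the ratios [(S d) i / y i], so [A y >= (r + e) y], against the
     maximality of [r]. *)
  have [|e e0 He] := @finite_lower_bound T (fun i => sumR (fun j => S i j * d j) / y i).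
    by move=> k; apply: Rdiv_lt_0_compat => //; apply: Spos.
  have sy : 0 < sumR y.
    by apply: Rlt_le_trans (y0 t0) _; apply: rsum_term => k; apply: Rlt_le.
  have : r + e <= r; last lra.
  apply: rmax; exists (fun k => / sumR y * y k); split.
  - by move=> k; apply: Rmult_le_pos; apply: Rlt_le => //; apply: Rinv_0_lt_compat.
  - by rewrite -rsum_mull Rinv_l //; lra.
  - move=> k.
    have -> : sumR (fun j => A k j * (/ sumR y * y j)) = / sumR y * sumR (fun j => A k j * y j).
      by rewrite rsum_mull; apply: eq_sumR => j; lra.
    rewrite Ay.
    have -> : (r + e) * (/ sumR y * y k) = / sumR y * ((r + e) * y k) by ring.
    apply: Rmult_le_compat_l; first by apply/Rlt_le/Rinv_0_lt_compat.
    have H : e * y k <= sumR (fun j => S k j * d j) / y k * y k.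
      by apply: Rmult_le_compat_r; [apply: Rlt_le|].
    have yk := y0 k.
    have E : sumR (fun j => S k j * d j) / y k * y k = sumR (fun j => S k j * d j) by field; lra.
    lra.
have sy : 0 < sumR y.
  by apply: Rlt_le_trans (y0 t0) _; apply: rsum_term => k; apply: Rlt_le.
exists r, (fun k => / sumR y * y k); split.
- by move=> k; apply: Rmult_lt_0_compat => //; apply: Rinv_0_lt_compat.
- by rewrite -rsum_mull Rinv_l //; lra.
- move=> k.
  have -> : sumR (fun j => A k j * (/ sumR y * y j)) = / sumR y * sumR (fun j => A k j * y j).
    by rewrite rsum_mull; apply: eq_sumR => j; lra.
  rewrite Ay.
  have -> : sumR (fun j => S k j * d j) = 0.
    transitivity (sumR (fun _ : T => 0)); first by apply: eq_sumR => j; rewrite dz; lra.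
    by rewrite rsum_const; lra.
  ring.
Qed.

End Perron.

Lemma rsum_Rabs (T : finType) (f : T -> R) : Rabs (sumR f) <= sumR (fun i => Rabs (f i)).
Proof.
apply: Rabs_le; split.
  have : sumR (fun i => - 1 * Rabs (f i)) <= sumR f.
    by apply: rsum_le => i; have := Rle_abs (- f i); rewrite Rabs_Ropp; lra.
  by rewrite -rsum_mull; lra.
by apply: rsum_le => i; exact: Rle_abs.
Qed.

(** Pairing with a positive left eigenvector [u] of eigenvalue [s] gives [u (A v) = s (u v)] for
    every [v]. With the right eigenvector it identifies the two Perron roots; with [|v|] it bounds
    every real eigenvalue by [s]. The [epsilon] in [pf_eig] therefore has a witness, and its value
    is [s]. *)
Lemma pf_eig_left (T : finType) (A : T -> T -> R) (t0 : T) :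
  (forall i j, 0 <= A i j) -> irreducible A ->
  exists u : T -> R, [/\ forall i, 0 < u i, sumR u = 1 &
    forall j, sumR (fun i => u i * A i j) = pf_eig A * u j].
Proof.
move=> A0 irrA.
have [r [x [x0 xs Ax]]] := perron_right t0 A0 irrA.
have [s [u [u0 us Au]]] := perron_right t0 (fun i j => A0 j i) (irreducible_tr irrA).
have {}Au j : sumR (fun i => u i * A i j) = s * u j.
  by rewrite -Au; apply: eq_sumR => i; lra.
have pair (v : T -> R) : sumR (fun i => u i * sumR (fun j => A i j * v j)) =
    s * sumR (fun j => u j * v j).
  under eq_sumR => i do rewrite rsum_mull.
  rewrite rsum_exch rsum_mull; apply: eq_sumR => j.
  rewrite -Rmult_assoc -Au Rmult_comm rsum_mull.
  by apply: eq_sumR => i; lra.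
have posu (v : T -> R) i : (forall j, 0 <= v j) -> 0 < v i -> 0 < sumR (fun j => u j * v j).
  move=> v0 vi.
  apply: (@Rlt_le_trans _ (u i * v i)); first exact: Rmult_lt_0_compat.
  by apply: (@rsum_term _ (fun j => u j * v j)) => j; apply: Rmult_le_pos => //; apply: Rlt_le.
have rs : r = s.
  have := pair x; under eq_sumR => i do rewrite Ax.
  have -> : sumR (fun i => u i * (r * x i)) = r * sumR (fun i => u i * x i).
    by rewrite rsum_mull; apply: eq_sumR => i; lra.
  move=> H; apply: (Rmult_eq_reg_r _ _ _ H).
  by have := posu x t0 (fun j => Rlt_le _ _ (x0 j)) (x0 t0); lra.
have max r' : is_real_eigenvalue A r' -> r' <= s.
  case=> v [[i vi] Av].
  pose a j := Rabs (v j).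
  have a0 j : 0 <= a j by exact: Rabs_pos.
  have pa : 0 < sumR (fun j => u j * a j) by apply: (posu a i a0); exact: Rabs_pos_lt.
  have : Rabs r' * sumR (fun j => u j * a j) <= s * sumR (fun j => u j * a j).
    rewrite -pair rsum_mull; apply: rsum_le => j.
    have -> : Rabs r' * (u j * a j) = u j * Rabs (r' * v j) by rewrite Rabs_mult /a; ring.
    apply: Rmult_le_compat_l; first exact: Rlt_le.
    rewrite -Av; apply: Rle_trans (rsum_Rabs _) _; apply: rsum_le => k.
    by rewrite Rabs_mult Rabs_right; [exact: Rle_refl|apply: Rle_ge].
  move=> H; apply: Rle_trans (Rle_abs r') _.
  exact: Rmult_le_reg_r pa H.
have [H1 H2] : is_real_eigenvalue A (pf_eig A) /\
    forall r', is_real_eigenvalue A r' -> r' <= pf_eig A.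
  apply: (epsilon_spec (inhabits R0) (fun r => is_real_eigenvalue A r /\
     forall r', is_real_eigenvalue A r' -> r' <= r)).
  exists s; split=> //; exists x; split; first by exists t0; have := x0 t0; lra.
  by move=> i; rewrite Ax rs.
have E : pf_eig A = s.
  apply: Rle_antisym; first exact: max.
  apply: H2; exists x; split; first by exists t0; have := x0 t0; lra.
  by move=> i; rewrite Ax rs.
by exists u; split=> // j; rewrite E.
Qed.

(* The constant depends on W only, which makes the estimate uniform in the
   tilting parameter of the matrices A dominating W. *)
Lemma pf_eig_left_uniform (T : finType) (W : T -> T -> R) (t0 : T) :
  stochastic W -> irreducible W ->
  exists2 c, 0 < c & forall A : T -> T -> R,
    (forall i j, W i j <= A i j <= 1) ->
    c <= pf_eig A <= INR #|T| /\ exists u : T -> R, [/\ forall i, c <= u i <= 1 &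
      forall j, sumR (fun i => u i * A i j) = pf_eig A * u j].
Proof.
case=> W0 W1 irrW.
have [m Hm] := irreducible_bounded irrW.
have Hn (p : T * T) : { n : nat | (n < m)%nat /\ 0 < matpow W n p.1 p.2 }.
  by apply: constructive_indefinite_description; have [n ? ?] := Hm p.1 p.2; exists n.
have [w w0 Hw] := @finite_lower_bound _ (fun p => matpow W (sval (Hn p)) p.1 p.2)
  (fun p => proj2 (svalP (Hn p))).
pose N := INR #|T|.
have N1 : 1 <= N.
  have /leP/le_INR // : (1 <= #|T|)%nat.
  by apply/card_gt0P; exists t0.
have Nm : 0 < N ^ m by apply: pow_lt; lra.
(* For each [i], some [n < m] gives [w * u i <= rho ^ n * u j <= N ^ m * u j]; summing over the [N]
   states [i], with [sumR u = 1], yields [u j >= w / (N * N ^ m)]. *)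
pose c := w / (N * N ^ m).
have c0 : 0 < c by apply: Rdiv_lt_0_compat => //; apply: Rmult_lt_0_compat => //; lra.
exists c => // A WA.
have A0 i j : 0 <= A i j by have := WA i j; have := W0 i j; lra.
have WA' i j : 0 <= W i j <= A i j by have := WA i j; have := W0 i j; lra.
have [u [u0 us Au]] := pf_eig_left t0 A0 (irreducible_le WA' irrW).
set rho := pf_eig A in Au *.
have rhoE : rho = sumR (fun i => u i * sumR (fun j => A i j)).
  rewrite -[rho]Rmult_1_r -us rsum_mull.
  under [RHS]eq_sumR => i do rewrite rsum_mull.
  by rewrite [RHS]rsum_exch; apply: eq_sumR => j; rewrite Au.
have rhoN : rho <= N.
  rewrite rhoE -[N]Rmult_1_r -us rsum_mull; apply: rsum_le => i.
  rewrite Rmult_comm; apply: Rmult_le_compat_r; first exact: Rlt_le.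
  rewrite -[N]Rmult_1_r /N -rsum_const; apply: rsum_le => j.
  by case: (WA i j).
have rho0 : 0 <= rho.
  rewrite rhoE; apply: rsum_ge0 => i; apply: Rmult_le_pos; first exact: Rlt_le.
  exact: rsum_ge0.
have u1 i : u i <= 1 by apply: simplex_le1 => // j; apply: Rlt_le.
have cu j : c <= u j.
  have : w <= N * (N ^ m * u j).
    rewrite -[w]Rmult_1_r -us rsum_mull /N -rsum_const; apply: rsum_le => i.
    have [nm _] := svalP (Hn (i, j)); have := Hw (i, j) => /=.
    move: (sval (Hn (i, j))) nm => n nm wn.
    apply: (@Rle_trans _ (rho ^ n * u j)).
      rewrite -(left_eigen_matpow n j Au).
      apply: (@Rle_trans _ (u i * matpow A n i j)).
        rewrite Rmult_comm; apply: Rmult_le_compat_l; first exact: Rlt_le.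
        exact: Rle_trans wn (matpow_le _ _ _ WA').
      apply: (@rsum_term _ (fun i => u i * matpow A n i j)) => k.
      by apply: Rmult_le_pos; [apply: Rlt_le|apply: matpow_ge0].
    apply: Rmult_le_compat_r; first exact: Rlt_le.
    apply: (@Rle_trans _ (N ^ n)); first by apply: pow_incr.
    by apply: Rle_pow => //; apply/leP/ltnW.
  move=> H; apply: (Rmult_le_reg_l (N * N ^ m)); first by apply: Rmult_lt_0_compat; lra.
  have -> : N * N ^ m * c = w by rewrite /c; field; lra.
  lra.
split; last by exists u.
split; last exact: rhoN.
(* The eigenvalue is bounded below through column [t0]: [u >= c] and [A >= W], whose columns sum to
   1. *)
apply: (@Rle_trans _ (rho * u t0)); last by have := u1 t0; nra.
rewrite -Au -[c]Rmult_1_r -(W1 t0) rsum_mull; apply: rsum_le => i.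
apply: Rmult_le_compat => //; first exact: Rlt_le.
by case: (WA i t0).
Qed.

(** * Total masses of chains *)

Lemma rsum_tuple0 (T : finType) (F : 0.-tuple T -> R) : sumR F = F [tuple].
Proof.
rewrite sumRE (big_pred1 [tuple]) // => s; by rewrite [s]tuple0 /= eqxx.
Qed.

Lemma rsum_tupleS (T : finType) k (F : k.+1.-tuple T -> R) :
  sumR F = sumR (fun a => sumR (fun s : k.-tuple T => F [tuple of a :: s])).
Proof.
rewrite -(rsum_pair (fun p : T * k.-tuple T => F [tuple of p.1 :: p.2])).
apply: (rsum_reindex (h := fun p : T * k.-tuple T => [tuple of p.1 :: p.2])).
exists (fun s : k.+1.-tuple T => (thead s, [tuple of behead s])).
  by case=> a s; rewrite /= theadE; congr pair; apply: val_inj.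
by move=> s /=; rewrite -tuple_eta.
Qed.

Section ChainSums.
Variable T : finType.
Implicit Types (p q : T -> R) (A B : T -> T -> R) (s : seq T).

Lemma chain_prob_ge0 A b s : (forall i j, 0 <= A i j) -> 0 <= chain_prob A b s.
Proof.
move=> A0; elim: s b => [|a s IH] b /=; first lra.
exact: Rmult_le_pos.
Qed.

Lemma seq_prob_ge0 p A s : (forall i, 0 <= p i) -> (forall i j, 0 <= A i j) ->
  0 <= seq_prob p A s.
Proof.
case: s => [|a s] p0 A0 /=; first lra.
by apply: Rmult_le_pos => //; apply: chain_prob_ge0.
Qed.

Lemma seq_prob_le p q A B s : (forall i, 0 <= p i <= q i) ->
  (forall i j, 0 <= A i j <= B i j) -> seq_prob p A s <= seq_prob q B s.
Proof.
move=> pq AB; case: s => [|a s] /=; first lra.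
have A0 i j : 0 <= A i j by case: (AB i j).
apply: Rmult_le_compat; [by case: (pq a)|exact: chain_prob_ge0|by case: (pq a)|].
elim: s a => [|b s IH] a /=; first lra.
by apply: Rmult_le_compat => //; [exact: chain_prob_ge0|case: (AB b a)].
Qed.

Lemma seq_prob_mul p q A B s :
  seq_prob p A s * seq_prob q B s =
  seq_prob (fun a => p a * q a) (fun a b => A a b * B a b) s.
Proof.
case: s => [|a s] /=; first lra.
suff <- : chain_prob A a s * chain_prob B a s =
  chain_prob (fun a b => A a b * B a b) a s by lra.
elim: s a => [|b s IH] a /=; first lra.
by rewrite -IH; lra.
Qed.

(** Used with [c = 1] for the laws of message and noise, and with [c = |X|] for the law of [Z^n]
    written on [X * Z]. *)
Lemma seq_prob_sum p A c k : sumR p = c -> (forall b, sumR (fun a => A a b) = c) ->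
  sumR (fun s : k.-tuple T => seq_prob p A s) = c ^ k.
Proof.
move=> pc Ac.
have chain_sum b l : sumR (fun s : l.-tuple T => chain_prob A b s) = c ^ l.
  elim: l b => [|l IH] b; first by rewrite rsum_tuple0.
  rewrite rsum_tupleS /=.
  under eq_sumR => a do rewrite -rsum_mull IH Rmult_comm.
  by rewrite -rsum_mull Ac Rmult_comm.
case: k => [|k]; first by rewrite rsum_tuple0.
rewrite rsum_tupleS /=.
under eq_sumR => a do rewrite -rsum_mull chain_sum Rmult_comm.
by rewrite -rsum_mull pc Rmult_comm.
Qed.

(** Weighting each path by [u] at its last state would give exactly [rho ^ k * u a]; since
    [c <= u <= 1], omitting this weight costs at most a factor [/ c]. *)
Lemma chain_sum_bounds A u rho c k a : 0 < c -> (forall i j, 0 <= A i j) ->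
  (forall i, c <= u i <= 1) ->
  (forall j, sumR (fun i => u i * A i j) = rho * u j) ->
  rho ^ k * u a <= sumR (fun s : k.-tuple T => chain_prob A a s) <= rho ^ k * u a / c.
Proof.
move=> c0 A0 uc Au; elim: k a => [|k IH] a.
  rewrite rsum_tuple0 /=; have [? ?] := uc a; split; first lra.
  by apply: (Rmult_le_reg_r c) => //; rewrite /Rdiv Rmult_assoc Rinv_l; lra.
rewrite rsum_tupleS /=; under eq_sumR => b do rewrite -rsum_mull.
have E : rho ^ k * rho * u a = sumR (fun b => A b a * (rho ^ k * u b)).
  by rewrite Rmult_assoc -Au rsum_mull; apply: eq_sumR => b; lra.
rewrite [rho * _]Rmult_comm E /Rdiv [_ * / c]Rmult_comm rsum_mull; split; apply: rsum_le => b.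
  by apply: Rmult_le_compat_l => //; case: (IH b).
rewrite -Rmult_assoc [/ c * _]Rmult_comm Rmult_assoc.
apply: Rmult_le_compat_l => //; rewrite Rmult_comm; by case: (IH b).
Qed.

End ChainSums.

(* Uniformity in (p, A) is what makes the moment generating functions
   comparable with powers of the Perron-Frobenius eigenvalue when the tilting
   parameter varies with the block length. *)
Lemma seq_prob_sum_uniform (T : finType) (P : T -> R) (W : T -> T -> R) :
  distribution P -> stochastic W -> irreducible W ->
  exists2 K, 0 < K & forall (p : T -> R) (A : T -> T -> R),
    (forall i, P i <= p i <= 1) -> (forall i j, W i j <= A i j <= 1) ->
    0 < pf_eig A /\ forall k,
      pf_eig A ^ k / K <= sumR (fun s : k.-tuple T => seq_prob p A s) <= K * pf_eig A ^ k.
Proof.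
case=> P0 P1 stW irrW.
have [t0 _] : exists t, 0 < P t by apply: rsum_ex_pos; lra.
have [c c0 Hc] := pf_eig_left_uniform t0 stW irrW.
pose N := INR #|T|.
have N1 : 1 <= N.
  have /leP/le_INR // : (1 <= #|T|)%nat.
  by apply/card_gt0P; exists t0.
(* A chain of length [k + 1] makes only [k] transitions. [N] bounds the initial mass, one [/ c]
   comes from [chain_sum_bounds], and the other from passing from [rho ^ k] to [rho ^ k.+1]. *)
have K0 : 0 < N / c ^ 2 by apply: Rdiv_lt_0_compat; [lra|apply: pow_lt].
exists (N / c ^ 2) => // p A Pp WA.
have [[crho rhoN] [u [uc Au]]] := Hc A WA.
rewrite -/N in rhoN; set rho := pf_eig A in crho rhoN Au *.
have rho0 : 0 < rho by lra.
have c1 : c <= 1 by have := uc t0; lra.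
have A0 i j : 0 <= A i j by have := WA i j; case: stW => /(_ i j); lra.
have p0 i : 0 <= p i by have := Pp i; have := P0 i; lra.
split=> //; case=> [|k].
  rewrite rsum_tuple0 /=; split.
    apply: (Rmult_le_reg_r (N / c ^ 2)) => //.
    have -> : 1 / (N / c ^ 2) * (N / c ^ 2) = 1 by field; lra.
    rewrite Rmult_1_l; apply: (Rmult_le_reg_r (c ^ 2)); first exact: pow_lt.
    have -> : N / c ^ 2 * c ^ 2 = N by field; lra.
    nra.
  apply: (Rmult_le_reg_r (c ^ 2)); first exact: pow_lt.
  have -> : N / c ^ 2 * 1 * c ^ 2 = N by field; lra.
  nra.
have ps1 : 1 <= sumR p by rewrite -P1; apply: rsum_le => i; case: (Pp i).
have psN : sumR p <= N.
  by rewrite -[N]Rmult_1_r /N -rsum_const; apply: rsum_le => i; case: (Pp i).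
have rk : 0 < rho ^ k by apply: pow_lt.
have [lo hi] : rho ^ k * c <= sumR (fun s : k.+1.-tuple T => seq_prob p A s) <=
    rho ^ k / c * N.
  rewrite rsum_tupleS /=; under eq_sumR => b do rewrite -rsum_mull.
  split.
    apply: (@Rle_trans _ (sumR (fun b => rho ^ k * c * p b))).
      have : 0 < rho ^ k * c by apply: Rmult_lt_0_compat.
      by rewrite -rsum_mull; nra.
    apply: rsum_le => b; rewrite Rmult_comm; apply: Rmult_le_compat_l => //.
    have [H _] := @chain_sum_bounds _ A u rho c k b c0 A0 uc Au.
    apply: Rle_trans H; apply: Rmult_le_compat_l; first lra.
    by case: (uc b).
  apply: (@Rle_trans _ (sumR (fun b => rho ^ k / c * p b))); last first.
    rewrite -rsum_mull; apply: Rmult_le_compat_l => //.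
    by apply/Rlt_le/Rdiv_lt_0_compat.
  apply: rsum_le => b; rewrite [X in _ <= X]Rmult_comm; apply: Rmult_le_compat_l => //.
  have [_ H] := @chain_sum_bounds _ A u rho c k b c0 A0 uc Au.
  apply: Rle_trans H _; apply: Rmult_le_compat_r; first by apply/Rlt_le/Rinv_0_lt_compat.
  by have := uc b; nra.
rewrite /=; split.
  apply: Rle_trans lo; apply: (Rmult_le_reg_r (N / c ^ 2)) => //.
  have -> : rho * rho ^ k / (N / c ^ 2) * (N / c ^ 2) = rho ^ k * rho by field; lra.
  rewrite Rmult_assoc; apply: Rmult_le_compat_l; first lra.
  apply: (Rmult_le_reg_r c) => //.
  have -> : c * (N / c ^ 2) * c = N by field; lra.
  by rewrite -[N]Rmult_1_r; apply: Rmult_le_compat; lra.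
apply: Rle_trans hi _; apply: (Rmult_le_reg_r (c ^ 2)); first exact: pow_lt.
have -> : rho ^ k / c * N * c ^ 2 = N * rho ^ k * c by field; lra.
have -> : N / c ^ 2 * (rho * rho ^ k) * c ^ 2 = N * rho ^ k * rho by field; lra.
apply: Rmult_le_compat_l; last lra.
by apply: Rmult_le_pos; [apply: Rle_trans N1; exact: Rle_0_1|exact: Rlt_le].
Qed.

(** * Entrywise powers and tilted entries *)

Lemma powz0 t : powz 0 t = 0.
Proof. by rewrite /powz; case: (Req_EM_T _ 0). Qed.
Lemma powz_pos a t : 0 < a -> powz a t = Rpower a t.
Proof. by move=> a0; rewrite /powz; case: (Req_EM_T _ 0) => // E; lra. Qed.
Lemma powz_ge0 a t : 0 <= powz a t.
Proof. by rewrite /powz; case: (Req_EM_T a 0) => ? /=; [lra|apply/Rlt_le/exp_pos]. Qed.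
Lemma powz1 t : powz 1 t = 1.
Proof. by rewrite powz_pos /Rpower ?ln_1 ?Rmult_0_r ?exp_0; lra. Qed.
Lemma powzM a b t : 0 <= a -> 0 <= b -> powz (a * b) t = powz a t * powz b t.
Proof.
case=> [a0|<-] [b0|<-]; rewrite ?Rmult_0_l ?Rmult_0_r ?powz0 ?Rmult_0_l ?Rmult_0_r //.
by rewrite !powz_pos ?Rpower_mult_distr //; apply: Rmult_lt_0_compat.
Qed.
Lemma powz_le1 a t : 0 <= a <= 1 -> 0 <= t -> powz a t <= 1.
Proof.
case=> -[a0|<-] a1 t0; last by rewrite powz0; lra.
rewrite powz_pos // -[X in _ <= X](powz1 t) powz_pos; last lra.
exact: Rle_Rpower_l.
Qed.
(** The exponents add up to 1 and [q ^ th >= a ^ th]. Nonnegative [th] is essential for this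
    direction, which confines the method to positive tilts. *)
Lemma powz_interp_ge a q th : 0 <= a <= q -> 0 <= th ->
  a <= powz a (1 - th) * powz q th.
Proof.
case=> -[a0|<-] aq th0; last by rewrite powz0; lra.
rewrite !powz_pos; try lra.
apply: (@Rle_trans _ (Rpower a (1 - th) * Rpower a th)).
  by rewrite -Rpower_plus Rplus_comm Rplus_minus Rpower_1; lra.
apply: Rmult_le_compat_l; first exact/Rlt_le/exp_pos.
exact: Rle_Rpower_l.
Qed.
Lemma powz_interp_le1 a q th : 0 <= a <= 1 -> 0 <= q <= 1 -> 0 <= th <= 1 ->
  powz a (1 - th) * powz q th <= 1.
Proof.
move=> a01 q01 th01; rewrite -[X in _ <= X]Rmult_1_r.
by apply: Rmult_le_compat; try exact: powz_ge0; apply: powz_le1; lra.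
Qed.

Lemma seq_prob_powz (T : finType) (p : T -> R) (A : T -> T -> R) t s :
  (forall i, 0 <= p i) -> (forall i j, 0 <= A i j) ->
  powz (seq_prob p A s) t =
  seq_prob (fun a => powz (p a) t) (fun a b => powz (A a b) t) s.
Proof.
move=> p0 A0; case: s => [|a s] /=; first exact: powz1.
rewrite powzM //; last exact: chain_prob_ge0.
congr Rmult; elim: s a => [|b s IH] a /=; first exact: powz1.
by rewrite powzM ?IH //; apply: chain_prob_ge0.
Qed.

(** * Converse and random coding bounds *)

Lemma finite_argmin (T : finType) (f : T -> R) (t0 : T) : exists i, forall j, f i <= f j.
Proof.
suff [i Hi] : exists i, forall j, j \in enum T -> f i <= f j.
  by exists i => j; apply: Hi; rewrite mem_enum.
elim: (enum T) => [|k s [i Hi]]; first by exists t0.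
have [ki|ki] := Rle_lt_dec (f k) (f i).
  exists k => j; rewrite inE => /orP[/eqP->|/Hi]; [exact: Rle_refl|exact: Rle_trans].
exists i => j; rewrite inE => /orP[/eqP->|/Hi //]; exact: Rlt_le.
Qed.

(* Coordinates m and m' of a uniformly random function are independent: the
   involution (e, b) |-> (e[m' := b], e m') exchanges e m' with a fresh b. *)
Lemma rsum_pairwise_indep (I J : finType) (m m' : I) (f g : J -> R) : m != m' ->
  INR #|J| * sumR (fun e : {ffun I -> J} => f (e m) * g (e m')) =
  sumR (fun e : {ffun I -> J} => f (e m)) * sumR g.
Proof.
move=> mm'.
transitivity (sumR (fun e : {ffun I -> J} => sumR (fun b : J => f (e m) * g (e m')))).
  by rewrite rsum_mull; apply: eq_sumR => e; rewrite rsum_const.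
transitivity (sumR (fun e : {ffun I -> J} => sumR (fun b : J => f (e m) * g b))); last first.
  rewrite Rmult_comm rsum_mull; apply: eq_sumR => e.
  by rewrite -rsum_mull Rmult_comm.
rewrite -(rsum_pair (fun p : {ffun I -> J} * J => f (p.1 m) * g (p.1 m'))).
rewrite -(rsum_pair (fun p : {ffun I -> J} * J => f (p.1 m) * g p.2)).
pose h (p : {ffun I -> J} * J) := ([ffun i => if i == m' then p.2 else p.1 i], p.1 m').
have hK : involutive h.
  case=> e b; rewrite /h /= ffunE eqxx; congr pair.
  by apply/ffunP => i; rewrite !ffunE; case: eqP => [->|].
rewrite (rsum_reindex _ (inv_bij hK)); apply: eq_sumR => -[e b] /=.
by rewrite !ffunE eqxx (negbTE mm').
Qed.

(** * The additive channel and the law of its side information *)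

Section Coding.
Variables (M : finType) (X : finZmodType) (Z : finType).
Variables (P1 : M -> R) (Ws : M -> M -> R).
Variables (PXZ1 : X * Z -> R) (Wc : X * Z -> X * Z -> R).
Hypothesis HP1 : distribution P1.
Hypothesis HWs : stochastic Ws.
Hypothesis HPXZ1 : distribution PXZ1.
Hypothesis HWc : stochastic Wc.
Hypothesis HA1 : assumption1 Wc.

(* The law of Z^n, written on the pair alphabet X * Z so that both laws are
   chains of the same shape. *)
Definition side_init (a : X * Z) : R := sumR (fun x => PXZ1 (x, a.2)).
Definition side_step (a b : X * Z) : R := WcZ Wc a.2 b.2.

Local Notation Pm m := (seq_prob P1 Ws m).
Local Notation Pn v := (seq_prob PXZ1 Wc v).
Local Notation PZ v := (seq_prob side_init side_step v).

Lemma side_init_ge a : 0 <= PXZ1 a <= side_init a.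
Proof.
case: HPXZ1 => H0 _; split=> //; case: a => x z.
exact: (@rsum_term _ (fun x => PXZ1 (x, z)) x (fun x => H0 (x, z))).
Qed.

Lemma side_step_ge a b : 0 <= Wc a b <= side_step a b.
Proof.
case: HWc => H0 _; split=> //; case: a b => x z [x' z'].
rewrite /side_step /WcZ /= -(HA1 z z' x').
exact: (@rsum_term _ (fun x => Wc (x, z) (x', z')) x (fun x => H0 (x, z) (x', z'))).
Qed.

Lemma side_init_sum1 : sumR (fun z => sumR (fun x => PXZ1 (x, z))) = 1.
Proof. by case: HPXZ1 => _ <-; rewrite rsum_exch rsum_pair. Qed.

Lemma side_step_sum1 z' : sumR (fun z => WcZ Wc z z') = 1.
Proof. by case: HWc => _ /(_ (GRing.zero, z')) <-; rewrite /WcZ rsum_exch rsum_pair. Qed.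

Lemma side_init_le1 a : side_init a <= 1.
Proof.
rewrite -side_init_sum1; apply: (@rsum_term _ (fun z => sumR (fun x => PXZ1 (x, z)))).
by move=> z; apply: rsum_ge0 => x; case: HPXZ1.
Qed.

Lemma side_step_le1 a b : side_step a b <= 1.
Proof.
rewrite -(side_step_sum1 b.2); apply: (@rsum_term _ (fun z => WcZ Wc z b.2)).
by move=> z; apply: rsum_ge0 => x; case: HWc.
Qed.

Lemma Pm_ge0 m : 0 <= Pm m.
Proof. by apply: seq_prob_ge0; [case: HP1|case: HWs]. Qed.
Lemma Pn_ge0 v : 0 <= Pn v.
Proof. by apply: seq_prob_ge0; [case: HPXZ1|case: HWc]. Qed.
Lemma Pn_le_PZ v : Pn v <= PZ v.
Proof. by apply: seq_prob_le; [exact: side_init_ge|exact: side_step_ge]. Qed.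
Lemma PZ_ge0 v : 0 <= PZ v.
Proof. by apply: Rle_trans (Pn_ge0 v) (Pn_le_PZ v). Qed.

Lemma Pm_sum1 k : sumR (fun m : k.-tuple M => Pm m) = 1.
Proof. by rewrite (@seq_prob_sum _ _ _ 1) ?pow1 //; [case: HP1|case: HWs]. Qed.
Lemma Pn_sum1 n : sumR (fun v : n.-tuple (X * Z) => Pn v) = 1.
Proof. by rewrite (@seq_prob_sum _ _ _ 1) ?pow1 //; [case: HPXZ1|case: HWc]. Qed.
(** The [X]-components are dummies here, and each position contributes a factor [|X|]. This is the
    origin of [|X|^n] in both coding bounds. *)
Lemma PZ_sum n : sumR (fun v : n.-tuple (X * Z) => PZ v) = INR #|X| ^ n.
Proof.
apply: seq_prob_sum => [|b].
  rewrite rsum_pair /side_init /=.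
  by under eq_sumR => x do rewrite side_init_sum1; rewrite rsum_const Rmult_1_r.
rewrite rsum_pair /side_step /=.
by under eq_sumR => x do rewrite side_step_sum1; rewrite rsum_const Rmult_1_r.
Qed.

Lemma noise_of_cons (x a : X) (z : Z) y u :
  noise_of ((x, z) :: y) (a :: u) = (GRing.add x (GRing.opp a), z) :: noise_of y u.
Proof. by []. Qed.

Lemma noise_of_subproof n (y : n.-tuple (X * Z)) (u : n.-tuple X) :
  size (noise_of y u) == n.
Proof. by rewrite size_map size_zip !size_tuple minnn. Qed.
Definition noise_tuple n (y : n.-tuple (X * Z)) (u : n.-tuple X) : n.-tuple (X * Z) :=
  Tuple (noise_of_subproof y u).

Lemma noise_ofK (y : seq (X * Z)) (u : seq X) : size y = size u ->
  noise_of (noise_of y u) (map (@GRing.opp X) u) = y.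
Proof.
elim: y u => [|[x z] y IH] [|a u] // [/IH E].
by rewrite map_cons !noise_of_cons E GRing.opprK GRing.subrK.
Qed.

Lemma noise_tuple_bij n (u : n.-tuple X) : bijective (fun y => @noise_tuple n y u).
Proof.
exists (fun y => noise_tuple y [tuple of map (@GRing.opp X) u]) => y; apply: val_inj => /=.
  by rewrite noise_ofK // !size_tuple.
have {2}-> : val u = map (@GRing.opp X) (map (@GRing.opp X) u).
  by rewrite -map_comp map_id_in // => a _ /=; rewrite GRing.opprK.
by rewrite noise_ofK // size_map !size_tuple.
Qed.

Lemma PZ_chain_snd b b' v : b.2 = b'.2 -> chain_prob side_step b v = chain_prob side_step b' v.
Proof. by case: v => [|a v] //= bb'; rewrite /side_step bb'. Qed.

Lemma PZ_noise n (y : n.-tuple (X * Z)) (u : n.-tuple X) : PZ (noise_of y u) = PZ y.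
Proof.
have : size y = size u by rewrite !size_tuple.
case: (val y) (val u) => [|[x z] y'] [|a u'] // [E].
rewrite noise_of_cons /= ; congr Rmult.
elim: y' u' x a z E => [|[x' z'] y' IH] [|a' u'] // x a z [E].
by rewrite noise_of_cons /= (IH _ x' a').
Qed.

Lemma shift_sum (f : X -> R) (x : X) : sumR (fun a => f (GRing.add x (GRing.opp a))) = sumR f.
Proof.
symmetry; apply: (rsum_reindex (h := fun a => GRing.add x (GRing.opp a))).
by apply: inv_bij => a; rewrite GRing.opprB GRing.addrC GRing.subrK.
Qed.

(** As the input runs through all words, so does the [X]-part of the noise. Assumption 1 makes each
    one-step sum independent of the previous [X]-component, so the sums can be carried out position
    by position. *)
Lemma Pn_marginal n (y : n.-tuple (X * Z)) :
  sumR (fun u : n.-tuple X => Pn (noise_of y u)) = PZ y.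
Proof.
have chain l (v : l.-tuple (X * Z)) b :
    sumR (fun u : l.-tuple X => chain_prob Wc b (noise_of v u)) = chain_prob side_step b v.
  elim: l v b => [|l IH] v b.
    by rewrite rsum_tuple0 [v]tuple0.
  case/tupleP: v => -[x z] v; rewrite rsum_tupleS.
  under eq_sumR => a do under eq_sumR => u do rewrite noise_of_cons /=.
  under eq_sumR => a.
    rewrite -rsum_mull IH (@PZ_chain_snd _ (x, z)) //.
    over.
  rewrite /= (shift_sum (fun a => Wc (a, z) b * chain_prob side_step (x, z) v)).
  rewrite [X in _ = X]Rmult_comm /side_step /WcZ /= -(HA1 z b.2 b.1) -surjective_pairing rsum_mull.
  by apply: eq_sumR => a; rewrite Rmult_comm.
case: n y => [|n] y; first by rewrite rsum_tuple0 [y]tuple0.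
case/tupleP: y => -[x z] v; rewrite rsum_tupleS.
under eq_sumR => a do under eq_sumR => u do rewrite noise_of_cons /=.
under eq_sumR => a.
  rewrite -rsum_mull chain (@PZ_chain_snd _ (x, z)) //.
  over.
rewrite /= (shift_sum (fun a => PXZ1 (a, z) * chain_prob side_step (x, z) v)).
rewrite [X in _ = X]Rmult_comm /side_init /= rsum_mull.
by apply: eq_sumR => a; rewrite Rmult_comm.
Qed.

(** [b] stands for correct decoding: on an error the weight [p * q] is charged to the error
    probability, otherwise the indicator itself bounds it by [t * z]. *)
Lemma converse_pointwise (p q t z : R) (b : bool) :
  0 <= p -> 0 <= q -> 0 <= t -> 0 <= z ->
  p * q * (if Rle_dec (p * q) (t * z) then 1 else 0) <=
  p * (if b then 0 else q) + (if b then t * z else 0).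
Proof.
move=> p0 q0 t0 z0; have pq := Rmult_le_pos _ _ p0 q0; have tz := Rmult_le_pos _ _ t0 z0.
by case: b; case: (Rle_dec _ _) => H /=; lra.
Qed.

(** [S] counts the competing messages accepted by the decoder: an error above the threshold [s]
    requires at least one. *)
Lemma achievability_pointwise (p q s S : R) (b : bool) :
  0 <= p -> 0 <= q -> 0 <= S -> (~~ b -> s < p * q -> 1 <= S) ->
  p * (if b then 0 else q) <=
  p * q * (if Rle_dec (p * q) s then 1 else 0) + p * (q * S).
Proof.
move=> p0 q0 S0; have pq := Rmult_le_pos _ _ p0 q0; have pqS := Rmult_le_pos _ _ pq S0.
case: b => /= H; case: (Rle_dec _ _) => [?|/Rnot_le_lt ?] /=; try lra.
have := Rmult_le_compat_l _ _ _ pq (H isT ltac:(lra)); lra.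
Qed.

(** * Coding bounds at fixed block lengths *)

Section Block.
Variables k n : nat.

(** The event [pi <= tau] with the denominator of [P_{X|Z}] cleared, so that no division by a
    vanishing [PZ v] occurs. *)
Definition low_likelihood (tau : R) (m : k.-tuple M) (v : seq (X * Z)) : R :=
  if Rle_dec (Pm m * Pn v) (tau * PZ v) then 1 else 0.

Definition low_likelihood_prob (tau : R) : R :=
  sumR (fun m : k.-tuple M => sumR (fun v : n.-tuple (X * Z) =>
    Pm m * Pn v * low_likelihood tau m v)).

(** Each output [y] is decoded to exactly one message, so the low-likelihood mass that is decoded
    correctly is at most the sum of [tau * PZ y] over [y]. *)
Lemma converse_bound (e : k.-tuple M -> n.-tuple X) (d : n.-tuple (X * Z) -> k.-tuple M) tau :
  0 <= tau ->
  low_likelihood_prob tau <= avg_err P1 Ws PXZ1 Wc e d + tau * INR #|X| ^ n.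
Proof.
move=> tau0.
have -> : tau * INR #|X| ^ n =
    sumR (fun m : k.-tuple M => sumR (fun y : n.-tuple (X * Z) =>
      if m == d y then tau * PZ y else 0)).
  rewrite rsum_exch -PZ_sum rsum_mull; apply: eq_sumR => y.
  by rewrite (rsum_delta (fun _ : k.-tuple M => tau * PZ y) (d y)).
rewrite /avg_err -rsum_add; apply: rsum_le => m.
rewrite (rsum_reindex (fun v : n.-tuple _ => Pm m * Pn v * _) (noise_tuple_bij (e m))).
rewrite rsum_mull -rsum_add.
apply: rsum_le => y; rewrite /low_likelihood /= PZ_noise eq_sym.
exact: (converse_pointwise _ (Pm_ge0 m) (Pn_ge0 _) tau0 (PZ_ge0 y)).
Qed.

(** Threshold decoding under a uniformly random encoder. Given [y], a wrong message [m'] passes the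
    test with probability at most [Pm m' / (tau * |X|^n)], since its codeword is uniform and
    independent of the one sent; summing over [m'] uses only that [Pm] has mass 1. *)
Lemma random_coding_bound tau : 0 < tau ->
  exists (e : k.-tuple M -> n.-tuple X) (d : n.-tuple (X * Z) -> k.-tuple M),
    avg_err P1 Ws PXZ1 Wc e d <= low_likelihood_prob tau + / (tau * INR #|X| ^ n).
Proof.
move=> tau0.
have [m0 _] : exists m : k.-tuple M, 0 < Pm m.
  by apply: rsum_ex_pos; rewrite Pm_sum1; lra.
pose x0 : X := GRing.zero.
have X0 : 0 < INR #|X| by apply: lt_0_INR; apply/ltP/card_gt0P; exists x0.
have Xn : 0 < INR #|X| ^ n by apply: pow_lt.
pose good (m : k.-tuple M) (y : n.-tuple (X * Z)) (u : n.-tuple X) : bool :=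
  if Rlt_dec (tau * PZ y) (Pm m * Pn (noise_of y u)) then true else false.
pose E := {ffun k.-tuple M -> n.-tuple X}.
(* Any accepted message may be returned; [m0] is an arbitrary default. *)
pose dec (e : E) y := if [pick m | good m y (e m)] is Some m then m else m0.
pose collide (e : E) := sumR (fun m : k.-tuple M => Pm m * sumR (fun y : n.-tuple (X * Z) =>
    Pn (noise_of y (e m)) * sumR (fun m' : k.-tuple M =>
      if (m' != m) && good m' y (e m') then 1 else 0))).
have err_le (e : E) : avg_err P1 Ws PXZ1 Wc e (dec e) <= low_likelihood_prob tau + collide e.
  rewrite /avg_err /low_likelihood_prob -rsum_add; apply: rsum_le => m.
  rewrite (rsum_reindex (fun v : n.-tuple _ => Pm m * Pn v * _) (noise_tuple_bij (e m))).
  rewrite !rsum_mull -rsum_add; apply: rsum_le => y; rewrite /= /low_likelihood PZ_noise.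
  apply: achievability_pointwise; [exact: Pm_ge0|exact: Pn_ge0| |].
    by apply: rsum_ge0 => m'; case: ifP => _; lra.
  move=> dm H.
  have gm : good m y (e m) by rewrite /good; case: (Rlt_dec _ _) => // nH; case: nH.
  move: dm; rewrite /dec; case: pickP => [m' gm' mm'|/(_ m)]; last by rewrite gm.
  have := @rsum_term _ (fun m' : k.-tuple M =>
    if (m' != m) && good m' y (e m') then 1 else 0) m'.
  by rewrite mm' gm' /=; apply=> j; case: ifP => _; lra.
(* Markov's inequality: each accepted [u] contributes more than [tau * PZ y] to a sum which
   [Pn_marginal] evaluates as [Pm m' * PZ y]. If [PZ y = 0], no word is accepted. *)
have good_count m' (y : n.-tuple (X * Z)) :
    sumR (fun u => if good m' y u then 1 else 0) <= Pm m' / tau.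
  have pm := Pm_ge0 m'; have pz := PZ_ge0 y.
  have Pmt : 0 <= Pm m' / tau.
    by apply: Rmult_le_pos => //; apply/Rlt_le/Rinv_0_lt_compat.
  case: (Req_dec (PZ y) 0) => [E0|E0].
    rewrite (@eq_sumR _ _ (fun=> 0)) ?rsum_const ?Rmult_0_r // => u.
    rewrite /good; case: (Rlt_dec _ _) => //= H; exfalso; move: H.
    have := Pn_le_PZ (noise_of y u); have := Pn_ge0 (noise_of y u).
    rewrite PZ_noise E0 => ? ?; have -> : Pn (noise_of y u) = 0 by lra.
    lra.
  have pz' : 0 < tau * PZ y by apply: Rmult_lt_0_compat; lra.
  apply: (Rmult_le_reg_l (tau * PZ y)) => //.
  have -> : tau * PZ y * (Pm m' / tau) = Pm m' * PZ y by field; lra.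
  rewrite -[in X in _ <= X]Pn_marginal !rsum_mull; apply: rsum_le => u.
  have : 0 <= Pm m' * Pn (noise_of y u) by apply: Rmult_le_pos => //; exact: Pn_ge0.
  rewrite /good; set a := tau * _; set b := Pm m' * _ => b0.
  by case: (Rlt_dec _ _) => /= H; lra.
have Jn : INR #|{: n.-tuple X}| = INR #|X| ^ n.
  by rewrite card_tuple; elim: n => [|j IH] //; rewrite expnS mult_INR IH.
have collide_sum : sumR collide <= sumR (fun _ : E => / (tau * INR #|X| ^ n)).
  rewrite /collide rsum_exch.
  have -> : sumR (fun _ : E => / (tau * INR #|X| ^ n)) =
    sumR (fun m : k.-tuple M => Pm m * (INR #|{: E}| * / (tau * INR #|X| ^ n))).
    under [RHS]eq_sumR => m do rewrite Rmult_comm.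
    by rewrite -rsum_mull Pm_sum1 rsum_const Rmult_1_r.
  apply: rsum_le => m; rewrite -rsum_mull; apply: Rmult_le_compat_l; first exact: Pm_ge0.
  (* The bound is spread over [m'], [y] and [e] with weights [Pm m'] and [Pn (noise_of y (e m))] of
     total mass 1, so that the two sides can be compared for each pair [(m', y)]. *)
  have -> : INR #|{: E}| * / (tau * INR #|X| ^ n) =
    sumR (fun m' : k.-tuple M => sumR (fun y : n.-tuple (X * Z) => sumR (fun e : E =>
      Pn (noise_of y (e m)) * (Pm m' * / (tau * INR #|X| ^ n))))).
    transitivity (sumR (fun m' : k.-tuple M => Pm m' * (INR #|{: E}| * / (tau * INR #|X| ^ n)))).
      under [RHS]eq_sumR => m' do rewrite Rmult_comm.
      by rewrite -rsum_mull Pm_sum1 Rmult_1_r.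
    apply: eq_sumR => m'; rewrite rsum_exch.
    transitivity (sumR (fun e : E => Pm m' * / (tau * INR #|X| ^ n))).
      by rewrite rsum_const -Rmult_assoc (Rmult_comm (Pm _)) Rmult_assoc.
    apply: eq_sumR => e; under [RHS]eq_sumR => y do rewrite Rmult_comm.
    rewrite -rsum_mull -(rsum_reindex (fun v : n.-tuple _ => Pn v) (noise_tuple_bij (e m))).
    by rewrite Pn_sum1 Rmult_1_r.
  rewrite rsum_exch.
  under eq_sumR => y do under eq_sumR => e do rewrite rsum_mull.
  under eq_sumR => y do rewrite rsum_exch.
  rewrite rsum_exch; apply: rsum_le => m'; apply: rsum_le => y.
  case: (boolP (m' == m)) => [_|mm'] /=.
    apply: rsum_le => e; rewrite Rmult_0_r; apply: Rmult_le_pos; first exact: Pn_ge0.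
    apply: Rmult_le_pos; first exact: Pm_ge0.
    by apply/Rlt_le/Rinv_0_lt_compat/Rmult_lt_0_compat.
  apply: (Rmult_le_reg_l (INR #|X| ^ n)) => //.
  rewrite -{1}Jn (rsum_pairwise_indep (fun u : n.-tuple X => Pn (noise_of y u))
    (fun u : n.-tuple X => if good m' y u then 1 else 0)) 1?eq_sym //.
  set F := sumR (fun e : E => Pn (noise_of y (e m))).
  have F0 : 0 <= F by apply: rsum_ge0 => e; exact: Pn_ge0.
  have -> : sumR (fun e : E => Pn (noise_of y (e m)) * (Pm m' * / (tau * INR #|X| ^ n))) =
     F * (Pm m' * / (tau * INR #|X| ^ n)).
    rewrite /F [RHS]Rmult_comm rsum_mull; apply: eq_sumR => e; exact: Rmult_comm.
  have -> : INR #|X| ^ n * (F * (Pm m' * / (tau * INR #|X| ^ n))) = F * (Pm m' / tau).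
    by field; split; lra.
  exact: Rmult_le_compat_l.
have [e He] : exists e : E, collide e <= / (tau * INR #|X| ^ n).
  apply: NNPP => nex.
  have e0 : E by exact: [ffun=> [tuple of nseq n x0]].
  have : sumR (fun _ : E => / (tau * INR #|X| ^ n)) < sumR collide; last lra.
  have lt e : / (tau * INR #|X| ^ n) < collide e.
    by apply: Rnot_le_lt => ?; apply: nex; exists e.
  by apply: (rsum_lt (i := e0)) => // e; apply: Rlt_le.
exists e, (dec e); have := err_le e; lra.
Qed.

(** Codes, seen as finite functions, form a finite type, so a minimiser exists and the [epsilon] is
    meaningful. [random_coding_bound] serves here only to show that some code exists. *)
Lemma Pj_min :
  (exists (e : k.-tuple M -> n.-tuple X) (d : n.-tuple (X * Z) -> k.-tuple M),
     avg_err P1 Ws PXZ1 Wc e d = Pj P1 Ws PXZ1 Wc k n) /\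
  forall (e : k.-tuple M -> n.-tuple X) (d : n.-tuple (X * Z) -> k.-tuple M),
     Pj P1 Ws PXZ1 Wc k n <= avg_err P1 Ws PXZ1 Wc e d.
Proof.
apply: (epsilon_spec (inhabits R0) (fun r =>
    (exists (e : k.-tuple M -> n.-tuple X) (d : n.-tuple (X * Z) -> k.-tuple M),
       avg_err P1 Ws PXZ1 Wc e d = r) /\
    forall (e : k.-tuple M -> n.-tuple X) (d : n.-tuple (X * Z) -> k.-tuple M),
       r <= avg_err P1 Ws PXZ1 Wc e d)).
have [e0 [d0 _]] := random_coding_bound Rlt_0_1.
pose T := ({ffun k.-tuple M -> n.-tuple X} * {ffun n.-tuple (X * Z) -> k.-tuple M})%type.
have t0 : T by exact: ([ffun m => e0 m], [ffun y => d0 y]).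
have [[e d] Hmin] := finite_argmin (fun p : T => avg_err P1 Ws PXZ1 Wc p.1 p.2) t0.
exists (avg_err P1 Ws PXZ1 Wc e d); split; first by exists e, d.
move=> e' d'; apply: Rle_trans (Hmin ([ffun m => e' m], [ffun y => d' y])) _.
apply/Req_le/eq_sumR => m /=; congr Rmult; apply: eq_sumR => y.
by rewrite !ffunE.
Qed.

End Block.
End Coding.

(** * Moderate deviations *)

Definition ev (Q : nat -> Prop) : Prop := exists N, forall n, Peano.le N n -> Q n.

Lemma ev_and Q1 Q2 : ev Q1 -> ev Q2 -> ev (fun n => Q1 n /\ Q2 n).
Proof.
case=> N1 H1 [N2 H2]; exists (N1 + N2)%coq_nat => n nN.
by split; [apply: H1|apply: H2]; lia.
Qed.

Lemma ev_mono (Q1 Q2 : nat -> Prop) : (forall n, Q1 n -> Q2 n) -> ev Q1 -> ev Q2.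
Proof. by move=> H [N HN]; exists N => n /HN /H. Qed.

Lemma Un_cv_ev_lt u l c : Un_cv u l -> l < c -> ev (fun n => u n < c).
Proof.
move=> ul lc; have [|N HN] := ul (c - l); first lra.
exists N => n /HN; rewrite /Rdist => /Rabs_def2[]; lra.
Qed.

Lemma Un_cv_ev_gt u l c : Un_cv u l -> c < l -> ev (fun n => c < u n).
Proof.
move=> ul lc; have [|N HN] := ul (l - c); first lra.
exists N => n /HN; rewrite /Rdist => /Rabs_def2[]; lra.
Qed.

Lemma Un_cv_ev_ext u v l : ev (fun n => u n = v n) -> Un_cv u l -> Un_cv v l.
Proof.
move=> [N1 H1] ul e /ul[N2 H2]; exists (N1 + N2)%coq_nat => n nN.
by rewrite -H1; [apply: H2|]; lia.
Qed.

Lemma cv_infty_ev a c : cv_infty a -> ev (fun n => c < a n).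
Proof. by move=> /(_ c)[N HN]; exists N. Qed.

Lemma ln_le_mono x y : 0 < x -> x <= y -> ln x <= ln y.
Proof. by move=> x0 [/(ln_increasing _ _ x0)/Rlt_le|->]; [|exact: Rle_refl]. Qed.

(** [a] is the speed and [b] the scale of the tilt. With [al = E * a] the residual error is
    [exp (- E * a)], already of the target order, while the cost [th * al = u * b * E * a] of the
    shifted threshold is o(a). *)
Lemma moderate_deviation_upper (P a b : nat -> R) (Lam : nat -> R -> R) (K D V eps : R) :
  0 < K -> 0 < D -> 0 < V -> 0 < eps ->
  Un_cv b 0 -> cv_infty a -> (forall n, 0 < b n) ->
  (forall u, 0 < u -> Un_cv (fun n => Lam n (u * b n) / a n) (- D * u + V * u ^ 2 / 2)) ->
  (forall n th al, 0 < th < 1 -> P n <= K * exp (th * al + Lam n th) + exp (- al)) ->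
  ev (fun n => P n <= exp (a n * (- (D ^ 2 / (2 * V)) + eps))).
Proof.
move=> K0 D0 V0 e0 b0 ainf bpos HLam HP.
pose E := D ^ 2 / (2 * V); pose u := D / V.
have u0 : 0 < u by apply: Rdiv_lt_0_compat.
have E0 : 0 < E by apply: Rdiv_lt_0_compat; [apply: pow_lt|lra].
have gE : - D * u + V * u ^ 2 / 2 = - E by rewrite /u /E; field; lra.
have e1 := Un_cv_ev_lt (HLam u u0) (c := - E + eps / 4) ltac:(rewrite gE; lra).
(* The first bound on [b n] keeps the tilt below 1; the second keeps the cost of the threshold below
   [a n * eps / 4]. *)
have c0 : 0 < Rmin (/ u) (eps / 4 / (u * E)).
  apply: Rmin_glb_lt; first exact: Rinv_0_lt_compat.
  by apply: Rdiv_lt_0_compat; [lra|apply: Rmult_lt_0_compat].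
have e2 := Un_cv_ev_lt b0 c0.
have e3 := cv_infty_ev (ln (K + 1) / (eps / 4)) ainf.
have e4 := cv_infty_ev 0 ainf.
apply: ev_mono (ev_and (ev_and e1 e2) (ev_and e3 e4)) => n [[H1 H2] [H3 a0]].
have bn := bpos n.
have ub1 : u * b n < 1.
  have := Rlt_le_trans _ _ _ H2 (Rmin_l _ _) => H.
  have := Rmult_lt_compat_l _ _ _ u0 H; rewrite Rinv_r; lra.
have ubE : u * b n * E < eps / 4.
  have := Rlt_le_trans _ _ _ H2 (Rmin_r _ _) => H.
  have uE : 0 < u * E by apply: Rmult_lt_0_compat.
  have := Rmult_lt_compat_l _ _ _ uE H.
  have -> : u * E * (eps / 4 / (u * E)) = eps / 4 by field; lra.
  lra.
have ub0 : 0 < u * b n by apply: Rmult_lt_0_compat.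
have LamE : Lam n (u * b n) < a n * (- E + eps / 4).
  have := Rmult_lt_compat_l _ _ _ a0 H1.
  have -> : a n * (Lam n (u * b n) / a n) = Lam n (u * b n) by field; lra.
  lra.
have lnK : ln (K + 1) < a n * (eps / 4).
  have e40 : 0 < eps / 4 by lra.
  have := Rmult_lt_compat_r _ _ _ e40 H3.
  have -> : ln (K + 1) / (eps / 4) * (eps / 4) = ln (K + 1) by field; lra.
  lra.
apply: Rle_trans (HP n (u * b n) (E * a n) (conj ub0 ub1)) _.
have X1 : exp (u * b n * (E * a n) + Lam n (u * b n)) <= exp (a n * (- E + eps / 2)).
  apply/Rlt_le/exp_increasing.
  have := Rmult_lt_compat_l _ _ _ a0 ubE; lra.
have X2 : exp (- (E * a n)) <= exp (a n * (- E + eps / 2)).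
  apply/Rlt_le/exp_increasing.
  have : 0 < a n * (eps / 2) by apply: Rmult_lt_0_compat; lra.
  lra.
have X3 : (K + 1) * exp (a n * (- E + eps / 2)) <= exp (a n * (- E + eps)).
  rewrite -[K + 1]exp_ln; last lra.
  rewrite -exp_plus; apply/Rlt_le/exp_increasing.
  have : 0 < a n * (eps / 4) by apply: Rmult_lt_0_compat; lra.
  lra.
have := Rmult_le_compat_l _ _ _ (Rlt_le _ _ K0) X1; rewrite -/E; lra.
Qed.

(** The tilt sits slightly to the right of the minimiser [D / V], where the limit parabola has slope
    [2 * eta]. The tilted measure then concentrates between [eta * a / b] and [3 * eta * a / b], a
    window that eventually lies above [al], of order [a], because [b] tends to 0. *)
Lemma moderate_deviation_lower (P a b : nat -> R) (Lam : nat -> R -> R) (K D V eps : R) :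
  0 < K -> 0 < D -> 0 < V -> 0 < eps ->
  Un_cv b 0 -> cv_infty a -> (forall n, 0 < b n) ->
  (forall u, 0 < u -> Un_cv (fun n => Lam n (u * b n) / a n) (- D * u + V * u ^ 2 / 2)) ->
  (forall n th1 th th2 al x y, 0 < th1 -> th1 < th < th2 -> th2 < 1 -> al <= x <= y ->
     exp (- th * y) * (exp (Lam n th) / K - K * exp ((th - th1) * x + Lam n th1)
       - K * exp (- (th2 - th) * y + Lam n th2)) - exp (- al) <= P n) ->
  ev (fun n => exp (a n * (- (D ^ 2 / (2 * V)) - eps)) <= P n).
Proof.
move=> K0 D0 V0 e0 b0 ainf bpos HLam HP.
pose E := D ^ 2 / (2 * V).
(* The total loss computed in [qE] is [(3 * eta * D + (4 + / 8) * eta ^ 2) / V]; with [eta <= 1] it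
   is at most [(3 * D + 5) * eta / V], hence at most [eps / 2]. *)
pose eta := Rmin 1 (eps * V / (2 * (3 * D + 5))).
have eta0 : 0 < eta.
  apply: Rmin_glb_lt; first lra.
  by apply: Rdiv_lt_0_compat; [apply: Rmult_lt_0_compat|lra].
have eta1 : eta <= 1 by exact: Rmin_l.
have etae : (3 * D + 5) * eta / V <= eps / 2.
  have H : eta <= eps * V / (2 * (3 * D + 5)) by exact: Rmin_r.
  apply: (Rmult_le_reg_r V) => //.
  have -> : (3 * D + 5) * eta / V * V = (3 * D + 5) * eta by field; lra.
  have D5 : 0 <= 3 * D + 5 by lra.
  have := Rmult_le_compat_l _ _ _ D5 H.
  have -> : (3 * D + 5) * (eps * V / (2 * (3 * D + 5))) = eps / 2 * V by field; lra.
  by [].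
(* [h] is the best shift of the tilt for both ends of the window: each off-window term then has
   exponent [g u - gam], strictly below the main one. *)
pose h := eta / V; pose u := (D + 2 * eta) / V; pose gam := h * eta / 2.
have h0 : 0 < h by apply: Rdiv_lt_0_compat.
have u0 : 0 < u by apply: Rdiv_lt_0_compat; lra.
have u10 : 0 < u - h.
  have -> : u - h = (D + eta) / V by rewrite /u /h; field; lra.
  by apply: Rdiv_lt_0_compat; lra.
have u20 : 0 < u + h by lra.
have gam0 : 0 < gam by apply: Rdiv_lt_0_compat; [apply: Rmult_lt_0_compat|lra].
pose g w := - D * w + V * w ^ 2 / 2.
have gu1 : g (u - h) + h * eta = g u - gam by rewrite /g /gam /u /h; field; lra.
have gu2 : g (u + h) - 3 * (h * eta) = g u - gam by rewrite /g /gam /u /h; field; lra.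
(* Exponent of the final bound: [- 3 * eta * u] is the price of undoing the tilt at the upper end of
   the window. *)
pose q := - 3 * eta * u + g u - gam / 4.
have qE : - E - eps / 2 <= q.
  have -> : q = - E - (3 * eta * D + (4 + / 8) * eta ^ 2) / V.
    by rewrite /q /g /gam /u /h /E; field; lra.
  suff : (3 * eta * D + (4 + / 8) * eta ^ 2) / V <= (3 * D + 5) * eta / V by lra.
  apply: Rmult_le_compat_r; first exact/Rlt_le/Rinv_0_lt_compat.
  nra.
have e1 := Un_cv_ev_gt (HLam u u0) (c := g u - gam / 4) ltac:(rewrite /g; lra).
have e2 := Un_cv_ev_lt (HLam (u - h) u10) (c := g (u - h) + gam / 4) ltac:(rewrite /g; lra).
have e3 := Un_cv_ev_lt (HLam (u + h) u20) (c := g (u + h) + gam / 4) ltac:(rewrite /g; lra).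
have q1 : 0 < Rabs (1 - q) + 1 by have := Rabs_pos (1 - q); lra.
have c0 : 0 < Rmin (/ (u + h)) (eta / (Rabs (1 - q) + 1)).
  by apply: Rmin_glb_lt; [exact: Rinv_0_lt_compat|exact: Rdiv_lt_0_compat].
have e4 := Un_cv_ev_lt b0 c0.
have e5 := cv_infty_ev (ln (4 * K * K) / (gam / 2)) ainf.
have e6 := cv_infty_ev (ln (4 * K)) ainf.
have e7 := cv_infty_ev (ln (4 * K) / (eps / 4)) ainf.
have e8 := cv_infty_ev 0 ainf.
apply: ev_mono (ev_and (ev_and (ev_and e1 e2) (ev_and e3 e4)) (ev_and (ev_and e5 e6) (ev_and e7 e8))).
move=> n [[[H1 H2] [H3 H4]] [[H5 H6] [H7 a0]]].
have bn := bpos n.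
have L1 : a n * (g u - gam / 4) < Lam n (u * b n).
  have := Rmult_lt_compat_l _ _ _ a0 H1.
  have -> // : a n * (Lam n (u * b n) / a n) = Lam n (u * b n) by field; lra.
have L2 : Lam n ((u - h) * b n) < a n * (g (u - h) + gam / 4).
  have := Rmult_lt_compat_l _ _ _ a0 H2.
  have -> // : a n * (Lam n ((u - h) * b n) / a n) = Lam n ((u - h) * b n) by field; lra.
have L3 : Lam n ((u + h) * b n) < a n * (g (u + h) + gam / 4).
  have := Rmult_lt_compat_l _ _ _ a0 H3.
  have -> // : a n * (Lam n ((u + h) * b n) / a n) = Lam n ((u + h) * b n) by field; lra.
have B1 : (u + h) * b n < 1.
  have := Rlt_le_trans _ _ _ H4 (Rmin_l _ _) => H.
  have := Rmult_lt_compat_l _ _ _ u20 H; rewrite Rinv_r; lra.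
have B2 : (1 - q) * b n <= eta.
  have H := Rlt_le_trans _ _ _ H4 (Rmin_r _ _).
  have := Rmult_lt_compat_l _ _ _ q1 H.
  have -> : (Rabs (1 - q) + 1) * (eta / (Rabs (1 - q) + 1)) = eta by field; lra.
  have := Rle_abs (1 - q); nra.
have D1 : 4 * K * K < exp (a n * (gam / 2)).
  have KK : 0 < 4 * K * K by apply: Rmult_lt_0_compat; lra.
  rewrite -[X in X < _]exp_ln //; apply: exp_increasing.
  have g2 : 0 < gam / 2 by lra.
  have := Rmult_lt_compat_r _ _ _ g2 H5.
  have -> // : ln (4 * K * K) / (gam / 2) * (gam / 2) = ln (4 * K * K) by field; lra.
have D2 : 4 * K < exp (a n).
  by rewrite -[X in X < _]exp_ln; [apply: exp_increasing|lra].
have D3 : 4 * K < exp (a n * (eps / 4)).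
  rewrite -[X in X < _]exp_ln; last lra.
  apply: exp_increasing.
  have g2 : 0 < eps / 4 by lra.
  have := Rmult_lt_compat_r _ _ _ g2 H7.
  have -> // : ln (4 * K) / (eps / 4) * (eps / 4) = ln (4 * K) by field; lra.
pose x := eta * a n / b n; pose y := 3 * eta * a n / b n.
have x0 : 0 < x.
  by apply: Rdiv_lt_0_compat => //; apply: Rmult_lt_0_compat.
have yx : y = 3 * x by rewrite /y /x; field; lra.
have alx : (1 - q) * a n <= x.
  have := Rmult_le_compat_r _ _ _ (Rlt_le _ _ a0) B2 => H.
  apply: (Rmult_le_reg_r (b n)) => //.
  have -> : x * b n = eta * a n by rewrite /x; field; lra.
  lra.
(* With [al = (1 - q) * a n] the subtracted term [exp (- al)] is [exp (- a n)] times the main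
   contribution [exp (a n * q)], hence negligible. *)
apply: Rle_trans (HP n ((u - h) * b n) (u * b n) ((u + h) * b n) ((1 - q) * a n) x y _ _ B1 _); last first.
- by split=> //; lra.
- split; apply: Rmult_lt_compat_r => //; lra.
- exact: Rmult_lt_0_compat.
have -> : - (u * b n) * y = a n * (- 3 * eta * u) by rewrite /y; field; lra.
have -> : (u * b n - (u - h) * b n) * x = a n * (h * eta) by rewrite /x; field; lra.
have -> : - ((u + h) * b n - u * b n) * y = a n * (- (3 * (h * eta))) by rewrite /y; field; lra.
pose G := exp (a n * (g u - gam / 4)).
have G0 : 0 < G by exact: exp_pos.
have T1 : G <= exp (Lam n (u * b n)) by exact/Rlt_le/exp_increasing.
have GE : exp (a n * (g u - gam + gam / 4)) * exp (a n * (gam / 2)) = G.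
  by rewrite -exp_plus; congr exp; field.
have T0 : exp (a n * (g u - gam + gam / 4)) * (4 * K * K) <= G.
  by rewrite -GE; apply: Rmult_le_compat_l; [exact/Rlt_le/exp_pos|exact: Rlt_le].
have T2 : exp (a n * (h * eta) + Lam n ((u - h) * b n)) <= exp (a n * (g u - gam + gam / 4)).
  by apply/Rlt_le/exp_increasing; rewrite -gu1; lra.
have T3 : exp (a n * (- (3 * (h * eta))) + Lam n ((u + h) * b n)) <= exp (a n * (g u - gam + gam / 4)).
  by apply/Rlt_le/exp_increasing; rewrite -gu2; lra.
set e := exp (a n * (g u - gam + gam / 4)) in T0 T2 T3.
have Ke : K * e <= G / (4 * K).
  apply: (Rmult_le_reg_r (4 * K)); first lra.
  have -> : G / (4 * K) * (4 * K) = G by field; lra.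
  lra.
have T4 : G / (2 * K) <= exp (Lam n (u * b n)) / K
     - K * exp (a n * (h * eta) + Lam n ((u - h) * b n))
     - K * exp (a n * (- (3 * (h * eta))) + Lam n ((u + h) * b n)).
  have := Rmult_le_compat_l _ _ _ (Rlt_le _ _ K0) T2.
  have := Rmult_le_compat_l _ _ _ (Rlt_le _ _ K0) T3.
  have : G / K <= exp (Lam n (u * b n)) / K.
    by apply: Rmult_le_compat_r => //; exact/Rlt_le/Rinv_0_lt_compat.
  have -> : G / K = G / (2 * K) + G / (4 * K) + G / (4 * K) by field; lra.
  lra.
have := Rmult_le_compat_l _ _ _ (Rlt_le _ _ (exp_pos (a n * (- 3 * eta * u)))) T4.
pose Q := exp (a n * q).
have Q0 : 0 < Q by exact: exp_pos.
have -> : exp (a n * (- 3 * eta * u)) * (G / (2 * K)) = Q / (2 * K).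
  have -> : Q = exp (a n * (- 3 * eta * u)) * G.
    by rewrite /Q /G -exp_plus; congr exp; rewrite /q; field.
  by field; lra.
have T5 : exp (- ((1 - q) * a n)) <= Q / (4 * K).
  apply: (Rmult_le_reg_r (4 * K)); first lra.
  have -> : Q / (4 * K) * (4 * K) = Q by field; lra.
  have -> : Q = exp (- ((1 - q) * a n)) * exp (a n).
    by rewrite /Q -exp_plus; congr exp; field.
  by apply: Rmult_le_compat_l; [exact/Rlt_le/exp_pos|exact: Rlt_le].
have T6 : exp (a n * (- E - eps)) <= Q / (4 * K).
  apply: (Rmult_le_reg_r (4 * K)); first lra.
  have -> : Q / (4 * K) * (4 * K) = Q by field; lra.
  apply: (@Rle_trans _ (exp (a n * (- E - eps)) * exp (a n * (eps / 4)))).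
    by apply: Rmult_le_compat_l; [exact/Rlt_le/exp_pos|exact: Rlt_le].
  rewrite -exp_plus /Q.
  have : a n * (- E - eps) + a n * (eps / 4) <= a n * q.
    by rewrite -Rmult_plus_distr_l; apply: Rmult_le_compat_l; lra.
  by case=> [/exp_increasing/Rlt_le|->]; [|exact: Rle_refl].
have : Q / (2 * K) = Q / (4 * K) + Q / (4 * K) by field; lra.
rewrite -/E; lra.
Qed.

Lemma moderate_deviation_limit (P a b : nat -> R) (Lam : nat -> R -> R) (K D V : R) :
  0 < K -> 0 < D -> 0 < V ->
  Un_cv b 0 -> cv_infty a -> (forall n, 0 < b n) ->
  (forall u, 0 < u -> Un_cv (fun n => Lam n (u * b n) / a n) (- D * u + V * u ^ 2 / 2)) ->
  (forall n th al, 0 < th < 1 -> P n <= K * exp (th * al + Lam n th) + exp (- al)) ->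
  (forall n th1 th th2 al x y, 0 < th1 -> th1 < th < th2 -> th2 < 1 -> al <= x <= y ->
     exp (- th * y) * (exp (Lam n th) / K - K * exp ((th - th1) * x + Lam n th1)
       - K * exp (- (th2 - th) * y + Lam n th2)) - exp (- al) <= P n) ->
  Un_cv (fun n => - / a n * ln (P n)) (D ^ 2 / (2 * V)).
Proof.
move=> K0 D0 V0 b0 ainf bpos HLam Hup Hlo eps e0.
have e20 : 0 < eps / 2 by lra.
have U := moderate_deviation_upper K0 D0 V0 e20 b0 ainf bpos HLam Hup.
have L := moderate_deviation_lower K0 D0 V0 e20 b0 ainf bpos HLam Hlo.
have [N HN] := ev_and (ev_and U L) (cv_infty_ev 0 ainf).
exists N => n /HN [[{}U {}L] a0].
have P0 : 0 < P n by apply: Rlt_le_trans L; exact: exp_pos.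
have {}L := ln_le_mono (exp_pos _) L; have {}U := ln_le_mono P0 U.
rewrite !ln_exp in L U.
have ai := Rinv_0_lt_compat _ a0.
have {}L := Rmult_le_compat_l _ _ _ (Rlt_le _ _ ai) L.
have {}U := Rmult_le_compat_l _ _ _ (Rlt_le _ _ ai) U.
rewrite -!Rmult_assoc Rinv_l ?Rmult_1_l in L U; try lra.
by rewrite /Rdist; apply: Rabs_def1; lra.
Qed.

(** * Moment generating function of the information density *)

Lemma exp_le_mono x y : x <= y -> exp x <= exp y.
Proof. by move=> [/exp_increasing/Rlt_le|->]; [|exact: Rle_refl]. Qed.

Section Tails.
Variables (T : finType) (w S L : T -> R) (al : R).
Hypothesis w0 : forall p, 0 <= w p.
Hypothesis L01 : forall p, 0 <= L p <= 1.

Definition mgf (th : R) : R := sumR (fun p => w p * exp (th * S p)).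

Lemma chernoff_bound th : 0 <= th ->
  (forall p, 0 < w p -> S p < al -> L p = 0) ->
  sumR (fun p => w p * L p) <= exp (- th * al) * mgf th.
Proof.
move=> th0 HL; rewrite /mgf rsum_mull; apply: rsum_le => p.
have {HL} := HL p; have := L01 p; case: (w0 p) => [wp|<-]; last by rewrite !Rmult_0_l; lra.
move=> [L0 L1] HL; case: (Rlt_le_dec (S p) al) => [/(HL wp)->|Sp].
  rewrite Rmult_0_r; apply: Rmult_le_pos; first exact/Rlt_le/exp_pos.
  by apply: Rmult_le_pos; apply: Rlt_le => //; exact: exp_pos.
have -> : exp (- th * al) * (w p * exp (th * S p)) = w p * exp (th * (S p - al)).
  by rewrite [w p * _]Rmult_comm -Rmult_assoc -exp_plus Rmult_comm; congr (_ * exp _); ring.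
apply: Rmult_le_compat_l; first lra.
apply: Rle_trans L1 _; rewrite -exp_0; apply: exp_le_mono.
by apply: Rmult_le_pos; lra.
Qed.

(* Pointwise, exp (th S) splits over S < x, x <= S <= y and S > y; off the window
   it is dominated by the exponentials with parameters th1 and th2. *)
Lemma tilting_lower_bound th1 th th2 x y : 0 <= th -> th1 <= th <= th2 ->
  (forall p, 0 < w p -> x <= S p -> L p = 1) ->
  exp (- th * y) * (mgf th - exp ((th - th1) * x) * mgf th1 - exp (- (th2 - th) * y) * mgf th2)
  <= sumR (fun p => w p * L p).
Proof.
move=> th0 [th1h hth2] HL.
have -> : sumR (fun p => w p * L p) =
    exp (- th * y) * (exp (th * y) * sumR (fun p => w p * L p)).
  rewrite -Rmult_assoc -exp_plus.
  have -> : - th * y + th * y = 0 by ring.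
  by rewrite exp_0 Rmult_1_l.
apply: Rmult_le_compat_l; first exact/Rlt_le/exp_pos.
suff : mgf th <= exp (th * y) * sumR (fun p => w p * L p) +
    (exp ((th - th1) * x) * mgf th1 + exp (- (th2 - th) * y) * mgf th2) by lra.
rewrite /mgf !rsum_mull -!rsum_add; apply: rsum_le => p.
have {HL} := HL p; have := L01 p; case: (w0 p) => [wp|<-]; last by rewrite !Rmult_0_l; lra.
move=> [L0 L1] HL.
have -> : exp (th * y) * (w p * L p) + (exp ((th - th1) * x) * (w p * exp (th1 * S p)) +
    exp (- (th2 - th) * y) * (w p * exp (th2 * S p))) =
  w p * (exp (th * y) * L p + (exp ((th - th1) * x + th1 * S p) +
    exp (- (th2 - th) * y + th2 * S p))) by rewrite !exp_plus; ring.
apply: Rmult_le_compat_l; first lra.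
have A1 := exp_pos ((th - th1) * x + th1 * S p).
have A2 := exp_pos (- (th2 - th) * y + th2 * S p).
have A3 := Rmult_le_pos _ _ (Rlt_le _ _ (exp_pos (th * y))) L0.
case: (Rlt_le_dec (S p) x) => [Sx|xS].
  have : exp (th * S p) <= exp ((th - th1) * x + th1 * S p).
    apply: exp_le_mono; have : 0 <= (th - th1) * (x - S p) by apply: Rmult_le_pos; lra.
    lra.
  lra.
case: (Rle_lt_dec (S p) y) => [Sy|yS].
  have : exp (th * S p) <= exp (th * y).
    by apply: exp_le_mono; apply: Rmult_le_compat_l.
  by rewrite (HL wp xS); lra.
have : exp (th * S p) <= exp (- (th2 - th) * y + th2 * S p).
  apply: exp_le_mono; have : 0 <= (th2 - th) * (S p - y) by apply: Rmult_le_pos; lra.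
    lra.
lra.
Qed.

End Tails.

(** * Error bounds through the tilted chains *)

Section OneShot.
Variables (M : finType) (X : finZmodType) (Z : finType).
Variables (P1 : M -> R) (Ws : M -> M -> R).
Variables (PXZ1 : X * Z -> R) (Wc : X * Z -> X * Z -> R).
Hypothesis HP1 : distribution P1.
Hypothesis HWs : stochastic Ws.
Hypothesis HPXZ1 : distribution PXZ1.
Hypothesis HWc : stochastic Wc.
Hypothesis HA1 : assumption1 Wc.
Hypothesis irrs : irreducible Ws.
Hypothesis irrc : irreducible Wc.

Local Notation Pm m := (seq_prob P1 Ws m).
Local Notation Pn v := (seq_prob PXZ1 Wc v).
Local Notation PZ v := (seq_prob (side_init PXZ1) (side_step Wc) v).

Definition joint_weight k n (p : k.-tuple M * n.-tuple (X * Z)) : R := Pm p.1 * Pn p.2.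
(** This is [-log pi]. Where the weight vanishes [ln] has no meaning, but such points do not count
    in [mgf], and the tail lemmas only look at positive weights. *)
Definition info_density k n (p : k.-tuple M * n.-tuple (X * Z)) : R :=
  ln (PZ p.2) - ln (joint_weight p).
Local Notation G k n := (mgf (@joint_weight k n) (@info_density k n)).

Lemma joint_weight_ge0 k n p : 0 <= @joint_weight k n p.
Proof. by apply: Rmult_le_pos; [exact: Pm_ge0|exact: Pn_ge0]. Qed.

Definition tilted_init th a := powz (PXZ1 a) (1 - th) * powz (side_init PXZ1 a) th.
Definition tilted_step th a b := powz (Wc a b) (1 - th) * powz (side_step Wc a b) th.

(** Pointwise, [w * exp (th * S)] equals [w ^ (1 - th) * PZ ^ th], and powers of chain probabilities
    are again chain products. Points of zero weight agree because [powz 0 _ = 0]. *)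
Lemma mgf_factor k n th : G k n th =
  sumR (fun m : k.-tuple M =>
    seq_prob (fun a => powz (P1 a) (1 - th)) (fun a b => powz (Ws a b) (1 - th)) m) *
  sumR (fun v : n.-tuple (X * Z) => seq_prob (tilted_init th) (tilted_step th) v).
Proof.
have PZ0 i : 0 <= side_init PXZ1 i by have := side_init_ge HPXZ1 i; lra.
have WZ0 i j : 0 <= side_step Wc i j by have := side_step_ge HWc HA1 i j; lra.
rewrite /mgf rsum_pair Rmult_comm rsum_mull; apply: eq_sumR => m.
rewrite Rmult_comm rsum_mull; apply: eq_sumR => v.
rewrite /tilted_init /tilted_step -seq_prob_mul.
rewrite -!seq_prob_powz //; try by case: HP1; case: HWs; case: HPXZ1; case: HWc.
rewrite /info_density /joint_weight /=.
case: (Pm_ge0 HP1 HWs m) => [pm|<-]; last by rewrite powz0 !Rmult_0_l.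
case: (Pn_ge0 HPXZ1 HWc v) => [pn|<-]; last by rewrite powz0 Rmult_0_r !Rmult_0_l Rmult_0_r.
have pz : 0 < PZ v := Rlt_le_trans _ _ _ pn (Pn_le_PZ HPXZ1 HWc HA1 v).
rewrite ln_mult // !powz_pos // /Rpower -!exp_plus.
rewrite -[X in X * _ * _](exp_ln _ pm) -[X in _ * X * _](exp_ln _ pn) -!exp_plus.
have H (a b c : R) : a + b + th * (c - (a + b)) = (1 - th) * a + ((1 - th) * b + th * c).
  by ring.
congr exp; exact: H.
Qed.

Lemma low_likelihood_pair k n tau :
  low_likelihood_prob P1 Ws PXZ1 Wc k n tau =
  sumR (fun p : k.-tuple M * n.-tuple (X * Z) =>
    joint_weight p * low_likelihood P1 Ws PXZ1 Wc tau p.1 p.2).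
Proof. by rewrite rsum_pair. Qed.

Lemma low_likelihood_01 k tau (m : k.-tuple M) v : 0 <= low_likelihood P1 Ws PXZ1 Wc tau m v <= 1.
Proof. by rewrite /low_likelihood; case: (Rle_dec _ _) => ? /=; lra. Qed.

Lemma info_density_ge k n al (p : k.-tuple M * n.-tuple (X * Z)) : 0 < joint_weight p ->
  al <= info_density p <-> joint_weight p <= exp (- al) * PZ p.2.
Proof.
move=> wp.
have pz : 0 < PZ p.2.
  apply: Rlt_le_trans (Pn_le_PZ HPXZ1 HWc HA1 p.2).
  case: (Pn_ge0 HPXZ1 HWc p.2) => // E; move: wp; rewrite /joint_weight -E Rmult_0_r; lra.
have -> : exp (- al) * PZ p.2 = exp (ln (PZ p.2) - al).
  by rewrite /Rminus exp_plus exp_ln // Rmult_comm.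
rewrite /info_density; split => H.
  by rewrite -[X in X <= _](exp_ln _ wp); apply: exp_le_mono; lra.
by have := ln_le_mono wp H; rewrite ln_exp; lra.
Qed.

Lemma low_likelihood1 k n al (p : k.-tuple M * n.-tuple (X * Z)) : 0 < joint_weight p ->
  al <= info_density p -> low_likelihood P1 Ws PXZ1 Wc (exp (- al)) p.1 p.2 = 1.
Proof.
move=> wp /(info_density_ge al wp) H; rewrite /low_likelihood.
by case: (Rle_dec _ _) => // nH; case: nH.
Qed.

Lemma low_likelihood0 k n al (p : k.-tuple M * n.-tuple (X * Z)) : 0 < joint_weight p ->
  info_density p < al -> low_likelihood P1 Ws PXZ1 Wc (exp (- al)) p.1 p.2 = 0.
Proof.
move=> wp H; rewrite /low_likelihood; case: (Rle_dec _ _) => // H'.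
by have : al <= info_density p; [exact/info_density_ge|lra].
Qed.

Lemma pow_exp_ln r k : 0 < r -> r ^ k = exp (INR k * ln r).
Proof. by move=> r0; rewrite -Rpower_pow. Qed.

Definition log_mgf_rate k n th : R :=
  INR k * (th * Hs_renyi Ws th) + INR n * (th * Hc_renyi Wc th).

Lemma mgf_uniform : exists2 K, 0 < K & forall k n th, 0 < th < 1 ->
  exp (log_mgf_rate k n th) / K <= G k n th <= K * exp (log_mgf_rate k n th).
Proof.
have [Ks Ks0 HKs] := seq_prob_sum_uniform HP1 HWs irrs.
have [Kc Kc0 HKc] := seq_prob_sum_uniform HPXZ1 HWc irrc.
exists (Ks * Kc); first exact: Rmult_lt_0_compat.
move=> k n th th01.
have [P0 Ps] := HP1; have [W0 Wsum] := HWs.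
have P1le i : P1 i <= 1 by rewrite -Ps; exact: rsum_term.
have Wsle i j : Ws i j <= 1 by rewrite -(Wsum j); exact: (@rsum_term _ (fun i => Ws i j)).
have interp a : 0 <= a <= 1 -> a <= powz a (1 - th) <= 1.
  move=> a01; split; last by apply: powz_le1; lra.
  by have := @powz_interp_ge a 1 th a01; rewrite powz1; lra.
have [||ls0 Hls] := HKs (fun a => powz (P1 a) (1 - th)) (fun a b => powz (Ws a b) (1 - th)).
- by move=> i; apply: interp.
- by move=> i j; apply: interp.
have [||lc0 Hlc] := HKc (tilted_init th) (tilted_step th).
- move=> i; have H := side_init_ge HPXZ1 i; have H1 := side_init_le1 HPXZ1 i.
  by split; [apply: powz_interp_ge; lra|apply: powz_interp_le1; lra].
- move=> i j; have H := side_step_ge HWc HA1 i j; have H1 := side_step_le1 HWc i j.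
  by split; [apply: powz_interp_ge; lra|apply: powz_interp_le1; lra].
have [{Hls}ls1 ls2] := Hls k; have [{Hlc}lc1 lc2] := Hlc n.
rewrite mgf_factor.
have thK a : th * (a / th) = a by field; lra.
(* Unfolding [side_step] turns [tilted_step th] into the very matrix inside [Hc_renyi], so the two
   eigenvalues coincide by conversion. *)
have -> : exp (log_mgf_rate k n th) =
    pf_eig (fun a b => powz (Ws a b) (1 - th)) ^ k * pf_eig (tilted_step th) ^ n.
  rewrite !pow_exp_ln // -exp_plus; congr exp; congr (_ * _ + _ * _).
    exact: thK.
  exact: thK.
move: ls1 ls2 lc1 lc2.
set A := _ ^ k; set B := _ ^ n; set s := sumR _; set c := sumR _.
have A0 : 0 < A by apply: pow_lt.
have B0 : 0 < B by apply: pow_lt.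
move=> ls1 ls2 lc1 lc2.
have AK : 0 < A / Ks by apply: Rdiv_lt_0_compat.
have BK : 0 < B / Kc by apply: Rdiv_lt_0_compat.
have -> : A * B / (Ks * Kc) = A / Ks * (B / Kc) by field; lra.
have -> : Ks * Kc * (A * B) = Ks * A * (Kc * B) by ring.
by split; apply: Rmult_le_compat; lra.
Qed.

(** Up to the uniform constant, the logarithm of the moment generating function of [info_density]
    centred at [n ln |X|], the reference point of both thresholds. *)
Definition log_mgf_excess k n th : R :=
  log_mgf_rate k n th - INR n * ln (INR #|X|) * th.

Lemma one_shot_bounds : exists2 K, 0 < K &
  (forall k n th al, 0 < th < 1 ->
    Pj P1 Ws PXZ1 Wc k n <= K * exp (th * al + log_mgf_excess k n th) + exp (- al)) /\
  (forall k n th1 th th2 al x y, 0 < th1 -> th1 < th < th2 -> th2 < 1 -> al <= x <= y ->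
     exp (- th * y) * (exp (log_mgf_excess k n th) / K
       - K * exp ((th - th1) * x + log_mgf_excess k n th1)
       - K * exp (- (th2 - th) * y + log_mgf_excess k n th2)) - exp (- al)
     <= Pj P1 Ws PXZ1 Wc k n).
Proof.
have [K K0 HK] := mgf_uniform.
have X0 : 0 < INR #|X|.
  by apply: lt_0_INR; apply/ltP/card_gt0P; exists (GRing.zero : X).
have Xn n : INR #|X| ^ n = exp (INR n * ln (INR #|X|)) by exact: pow_exp_ln.
exists K => //; split.
  move=> k n th al th01.
  set r := INR n * ln (INR #|X|).
  have [_ Hmin] := Pj_min HP1 HWs HPXZ1 HWc HA1 k n.
  have [e [d Hed]] := random_coding_bound HP1 HWs HPXZ1 HWc HA1 k n (exp_pos (- (r - al))).
  apply: Rle_trans (Hmin e d) _; apply: Rle_trans Hed _.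
  have -> : / (exp (- (r - al)) * INR #|X| ^ n) = exp (- al).
    by rewrite Xn -exp_plus -exp_Ropp; congr exp; rewrite /r; ring.
  apply: Rplus_le_compat_r; rewrite low_likelihood_pair.
  have th0 : 0 <= th by lra.
  apply: Rle_trans (chernoff_bound (joint_weight_ge0 (k:=k) (n:=n))
    (fun p => low_likelihood_01 _ p.1 p.2) th0 (@low_likelihood0 k n (r - al))) _.
  have [_ H] := HK k n th th01.
  apply: Rle_trans (Rmult_le_compat_l _ _ _ (Rlt_le _ _ (exp_pos _)) H) _.
  right; rewrite -Rmult_assoc [_ * K]Rmult_comm Rmult_assoc -exp_plus.
  by congr (_ * exp _); rewrite /log_mgf_excess /r; ring.
move=> k n th1 th th2 al x y th10 [th1h hth2] th21 [alx xy].
set r := INR n * ln (INR #|X|).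
have [[e [d <-]] _] := Pj_min HP1 HWs HPXZ1 HWc HA1 k n.
have := converse_bound HP1 HWs HPXZ1 HWc HA1 e d (Rlt_le _ _ (exp_pos (- (al + r)))).
have -> : exp (- (al + r)) * INR #|X| ^ n = exp (- al).
  by rewrite Xn -exp_plus; congr exp; rewrite /r; ring.
rewrite low_likelihood_pair.
have th0 : 0 <= th by lra.
have hh : th1 <= th <= th2 by lra.
(* As [al <= x], the window shifted by [r] lies inside the low-likelihood event. *)
have HL p : 0 < @joint_weight k n p -> x + r <= info_density p ->
    low_likelihood P1 Ws PXZ1 Wc (exp (- (al + r))) p.1 p.2 = 1.
  by move=> wp H; apply: low_likelihood1 => //; lra.
have := tilting_lower_bound (joint_weight_ge0 (k:=k) (n:=n))
    (fun p => low_likelihood_01 (exp (- (al + r))) p.1 p.2) (y + r) th0 hh HL.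
have [H1 _] := HK k n th ltac:(lra).
have [_ H2] := HK k n th1 ltac:(lra).
have [_ H3] := HK k n th2 ltac:(lra).
set LL := sumR _.
suff : exp (- th * y) * (exp (log_mgf_excess k n th) / K
       - K * exp ((th - th1) * x + log_mgf_excess k n th1)
       - K * exp (- (th2 - th) * y + log_mgf_excess k n th2)) <=
  exp (- th * (y + r)) * (G k n th - exp ((th - th1) * (x + r)) * G k n th1
       - exp (- (th2 - th) * (y + r)) * G k n th2) by lra.
have -> : exp (- th * (y + r)) = exp (- th * y) * exp (- th * r).
  by rewrite -exp_plus; congr exp; ring.
rewrite Rmult_assoc; apply: Rmult_le_compat_l; first exact/Rlt_le/exp_pos.
have E t : exp (log_mgf_excess k n t) = exp (- t * r) * exp (log_mgf_rate k n t).
  by rewrite -exp_plus; congr exp; rewrite /log_mgf_excess /r; ring.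
rewrite !(exp_plus _ (log_mgf_excess _ _ _)) !E.
have X1 := Rmult_le_compat_l _ _ _ (Rlt_le _ _ (exp_pos (- th * r))) H1.
have E2 : exp (- th * r) * exp ((th - th1) * (x + r)) = exp ((th - th1) * x) * exp (- th1 * r).
  by rewrite -!exp_plus; congr exp; ring.
have E3 : exp (- th * r) * exp (- (th2 - th) * (y + r)) = exp (- (th2 - th) * y) * exp (- th2 * r).
  by rewrite -!exp_plus; congr exp; ring.
have p2 : 0 <= exp ((th - th1) * x) * exp (- th1 * r).
  by apply: Rmult_le_pos; apply/Rlt_le/exp_pos.
have p3 : 0 <= exp (- (th2 - th) * y) * exp (- th2 * r).
  by apply: Rmult_le_pos; apply/Rlt_le/exp_pos.
have X2 := Rmult_le_compat_l _ _ _ p2 H2.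
have X3 := Rmult_le_compat_l _ _ _ p3 H3.
rewrite !Rmult_minus_distr_l -[exp (- th * r) * (exp ((th - th1) * (x + r)) * _)]Rmult_assoc E2.
rewrite -[exp (- th * r) * (exp (- (th2 - th) * (y + r)) * _)]Rmult_assoc E3.
lra.
Qed.

End OneShot.

(** * Second order asymptotics *)

Lemma limit1_in_Un_cv (f : R -> R) D l s :
  limit1_in f D l 0 -> (forall n, D (s n)) -> Un_cv s 0 -> Un_cv (fun n => f (s n)) l.
Proof.
move=> fl Ds s0 e /fl[al [al0 H]]; have [N HN] := s0 al al0.
by exists N => n nN; apply: H; split=> //; exact: HN.
Qed.

Lemma Rpower_cv_infty p : 0 < p -> cv_infty (fun n => Rpower (INR n) p).
Proof.
move=> p0 c; pose d := Rmax c 1.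
have d0 : 0 < d by have := Rmax_r c 1; rewrite -/d; lra.
have [N HN] := INR_unbounded (Rpower d (/ p)).
exists N => n /le_INR nN.
apply: Rle_lt_trans (Rmax_l c 1) _; rewrite -/d.
have {1}-> : d = Rpower (Rpower d (/ p)) p.
  by rewrite Rpower_mult Rinv_l ?Rpower_1 //; lra.
by apply: Rlt_Rpower_l => //; split; [exact: exp_pos|lra].
Qed.

Lemma Rpower_neg_cv0 p : 0 < p -> Un_cv (fun n => Rpower (INR n) (- p)) 0.
Proof.
move=> p0; apply: (Un_cv_ev_ext (u := fun n => / Rpower (INR n) p)).
  by exists 0%nat => n _; rewrite Rpower_Ropp.
apply: (cv_infty_cv_0 (fun n => Rpower (INR n) p)) (Rpower_cv_infty p0).
Qed.

Lemma Int_part_to_nat_bounds x : 0 <= x ->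
  0 <= x - INR (Z.to_nat (Int_part x)) <= 1.
Proof.
move=> x0; have [H1 H2] := base_Int_part x.
have z0 : (0 <= Int_part x)%Z.
  have : (-1 < Int_part x)%Z by apply: lt_IZR; lra.
  lia.
rewrite INR_IZR_INZ Znat.Z2Nat.id //; lra.
Qed.

Section ExcessLimit.
Variables (Hs_fun Hc_fun : R -> R) (Hs Vs Hc Vc L t delta : R).
Hypothesis HVs : limit1_in (fun th => 2 * (Hs_fun th - Hs) / th) (fun th => th <> 0) Vs 0.
Hypothesis HVc : limit1_in (fun th => 2 * (Hc_fun th - Hc) / th) (fun th => th <> 0) Vc 0.
Hypothesis Hpos : 0 < Hs.
Hypothesis Cpos : 0 < L - Hc.
Hypothesis Ht : 0 < t < 1 / 2.
Local Notation C := (L - Hc).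
Local Notation a := (fun n : nat => Rpower (INR n) (1 - 2 * t)).
Local Notation b := (fun n : nat => Rpower (INR n) (- t)).
Local Notation k := (kn C Hs delta t).

Definition rounding (n : nat) : R :=
  INR n * C / Hs - delta * Rpower (INR n) (1 - t) - INR (k n).

(** [n * C / Hs] dominates [delta * n ^ (1 - t)], so the argument of the floor is eventually
    nonnegative and the truncation at 0 in [kn] has no effect. *)
Lemma rounding_bounds : ev (fun n => 0 <= rounding n <= 1).
Proof.
have [|c c0] := Un_cv_ev_lt (@Rpower_neg_cv0 t ltac:(lra)) (c := C / Hs / (Rabs delta + 1)).
  by apply: Rdiv_lt_0_compat; [exact: Rdiv_lt_0_compat|have := Rabs_pos delta; lra].
exists (c + 1)%coq_nat => n cn; apply: Int_part_to_nat_bounds.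
have n0 : 0 < INR n by apply: lt_0_INR; lia.
have -> : Rpower (INR n) (1 - t) = INR n * b n by rewrite Rpower_plus Rpower_1.
have H := c0 n ltac:(lia).
have d1 : 0 < Rabs delta + 1 by have := Rabs_pos delta; lra.
have {H} := Rmult_lt_compat_l _ _ _ d1 H.
have -> : (Rabs delta + 1) * (C / Hs / (Rabs delta + 1)) = C / Hs by field; lra.
have b0 : 0 < b n by exact: exp_pos.
have := Rle_abs delta => H1 H2.
have -> : INR n * C / Hs - delta * (INR n * b n) = INR n * (C / Hs - delta * b n) by field; lra.
by apply: Rmult_le_pos; [lra|nra].
Qed.

Lemma excess_limit u : 0 < u ->
  Un_cv (fun n => (INR (k n) * (u * b n * Hs_fun (u * b n)) +
      INR n * (u * b n * Hc_fun (u * b n)) - INR n * L * (u * b n)) / a n)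
    (- (delta * Hs) * u + (C / Hs * Vs + Vc) * u ^ 2 / 2).
Proof.
move=> u0.
have b0 : Un_cv b 0 by apply: Rpower_neg_cv0; lra.
have bp n : 0 < b n by exact: exp_pos.
have ub0 : Un_cv (fun n => u * b n) 0.
  by rewrite -(Rmult_0_r u); apply: (CV_mult (fun _ => u) b) => //; exact: Un_cv_const.
have ubn n : u * b n <> 0 by have := Rmult_lt_0_compat _ _ u0 (bp n); lra.
have vcv := limit1_in_Un_cv HVs ubn ub0.
have wcv := limit1_in_Un_cv HVc ubn ub0.
set v := (fun n => _) in vcv; set w := (fun n => _) in wcv.
pose r n := rounding n * (b n / a n).
have rcv : Un_cv r 0.
  have [N1 H1] := rounding_bounds.
  have [|N2 H2] := cv_infty_ev 1 (@Rpower_cv_infty (1 - 2 * t) _); first lra.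
  move=> e /b0[N3 H3]; exists (N1 + (N2 + N3)%coq_nat)%coq_nat => n nN.
  have [f0 f1] := H1 n ltac:(lia); have a1 := H2 n ltac:(lia).
  have := H3 n ltac:(lia); have bn := bp n.
  rewrite /Rdist !Rminus_0_r (Rabs_right (b n)); last lra.
  apply: Rle_lt_trans; rewrite /r Rabs_right; last first.
    by apply/Rle_ge/Rmult_le_pos => //; apply/Rlt_le/Rdiv_lt_0_compat; lra.
  have ba : b n / a n <= b n.
    apply: (Rmult_le_reg_r (a n)); first lra.
    have -> : b n / a n * a n = b n by field; lra.
    nra.
  have ba0 : 0 < b n / a n by apply: Rdiv_lt_0_compat; lra.
  nra.
(* The second order quotients [v], [w] are substituted exactly, without remainder. Since
   [a = n * b ^ 2], the factor of [v n] is [k n / n], and rounding enters only through [r], which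
   tends to 0. *)
pose F n := - (delta * Hs) * u - u * Hs * r n +
  u ^ 2 / 2 * ((C / Hs - delta * b n - b n * r n) * v n + w n).
apply: (Un_cv_ev_ext (u := F)).
  exists 1%nat => n n1.
  have n0 : 0 < INR n by apply: lt_0_INR; lia.
  have bn := bp n.
  have aE : a n = INR n * b n ^ 2.
    have -> : 1 - 2 * t = 1 + - t + - t by ring.
    by rewrite !Rpower_plus Rpower_1 //; ring.
  have kE : INR (k n) = INR n * C / Hs - delta * (INR n * b n) - rounding n.
    rewrite /rounding.
    have -> : Rpower (INR n) (1 - t) = INR n * b n by rewrite Rpower_plus Rpower_1.
    ring.
  have vE : Hs_fun (u * b n) = Hs + u * b n / 2 * v n.
    by rewrite /v; field; lra.
  have wE : Hc_fun (u * b n) = Hc + u * b n / 2 * w n.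
    by rewrite /w; field; lra.
  rewrite vE wE kE /F /r aE; move: (v n) (w n) (rounding n) (b n) bn => vn wn rn bn' bn0.
  by field; lra.
have -> : - (delta * Hs) * u + (C / Hs * Vs + Vc) * u ^ 2 / 2 =
  - (delta * Hs) * u - u * Hs * 0 + u ^ 2 / 2 * ((C / Hs - delta * 0 - 0 * 0) * Vs + Vc).
  by field; lra.
have cst c := Un_cv_const c.
apply: (CV_plus (fun n => - (delta * Hs) * u - u * Hs * r n)
  (fun n => u ^ 2 / 2 * ((C / Hs - delta * b n - b n * r n) * v n + w n))).
  apply: (CV_minus (fun _ => - (delta * Hs) * u) (fun n => u * Hs * r n)) => //.
  exact: (CV_mult (fun _ => u * Hs) r).
apply: (CV_mult (fun _ => u ^ 2 / 2)
  (fun n => (C / Hs - delta * b n - b n * r n) * v n + w n)) => //.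
apply: (CV_plus (fun n => (C / Hs - delta * b n - b n * r n) * v n) w) => //.
apply: (CV_mult (fun n => C / Hs - delta * b n - b n * r n) v) => //.
apply: (CV_minus (fun n => C / Hs - delta * b n) (fun n => b n * r n)).
  apply: (CV_minus (fun _ => C / Hs) (fun n => delta * b n)) => //.
  exact: (CV_mult (fun _ => delta) b).
exact: (CV_mult b r).
Qed.

End ExcessLimit.

Theorem mainTheorem17
  (M : finType) (P1 : M -> R) (Ws : M -> M -> R)
  (X : finZmodType) (Z : finType) (PXZ1 : X * Z -> R)
  (Wc : X * Z -> X * Z -> R)
  (HP1 : distribution P1) (HWs : irr_aper_transition Ws)
  (HPXZ1 : distribution PXZ1) (HWc : irr_aper_transition Wc)
  (HA1 : assumption1 Wc)
  (Hs Vs Hc Vc : R)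
  (HHs : limit1_in (Hs_renyi Ws) (fun th => th <> 0) Hs 0)
  (HVs : limit1_in (fun th => 2 * (Hs_renyi Ws th - Hs) / th)
                   (fun th => th <> 0) Vs 0)
  (HHc : limit1_in (Hc_renyi Wc) (fun th => th <> 0) Hc 0)
  (HVc : limit1_in (fun th => 2 * (Hc_renyi Wc th - Hc) / th)
                   (fun th => th <> 0) Vc 0)
  (Hpos : 0 < Hs)
  (Cpos : 0 < ln (INR #|X|) - Hc)
  (Vpos : 0 < (ln (INR #|X|) - Hc) / Hs * Vs + Vc)
  (t delta : R) (Ht : 0 < t < 1 / 2) (Hdelta : 0 < delta) :
  let C := ln (INR #|X|) - Hc in
  Un_cv (fun n : nat =>
           - / Rpower (INR n) (1 - 2 * t) *
             ln (Pj P1 Ws PXZ1 Wc (kn C Hs delta t n) n))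
        (1 / 2 * (delta ^ 2 /
           (1 / Hs ^ 2 * (C / Hs * Vs + Vc)))).
Proof.
move=> C.
have [stWs [irrs _]] := HWs; have [stWc [irrc _]] := HWc.
have [K K0 [Hup Hlo]] := one_shot_bounds HP1 stWs HPXZ1 stWc HA1 irrs irrc.
have -> : 1 / 2 * (delta ^ 2 / (1 / Hs ^ 2 * (C / Hs * Vs + Vc))) =
    (delta * Hs) ^ 2 / (2 * (C / Hs * Vs + Vc)).
  set V := C / Hs * Vs + Vc; have V0 : 0 < V by exact: Vpos.
  by field; split; lra.
apply: (@moderate_deviation_limit
  (fun n => Pj P1 Ws PXZ1 Wc (kn C Hs delta t n) n) (fun n => Rpower (INR n) (1 - 2 * t))
  (fun n => Rpower (INR n) (- t))
  (fun n => log_mgf_excess Ws Wc (kn C Hs delta t n) n) K (delta * Hs) (C / Hs * Vs + Vc)) => //.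
- exact: Rmult_lt_0_compat.
- by apply: Rpower_neg_cv0; lra.
- by apply: Rpower_cv_infty; lra.
- by move=> n; exact: exp_pos.
- by move=> u u0; exact: (excess_limit delta HVs HVc Hpos Cpos Ht u0).
- by move=> n; exact: Hup.
- by move=> n; exact: Hlo.
Qed.
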